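(* Let $d=1$, let $W$ be an admissible interaction potential, let $\mu^0\in\mathscr{P}$, and let $\mu$ be the gradient flow solution of the interaction system with initial datum $\mu^0$. Let $i\in\{1,\ldots,n\}$ be fixed, but arbitrary. Assume that for all $j\in\{1,\ldots,n\}$ the maps $W_{ij}'$ are Lipschitz-continuous. Suppose moreover that $\operatorname{supp}\mu^0_i$ is a (possibly unbounded) interval and that $\mu^0_i$ is absolutely continuous with respect to the Lebesgue measure, with a Lebesgue density that is continuous on the interior of $\operatorname{supp}\mu^0_i$ and globally bounded. Then $\mu_i(t)$ is absolutely continuous with respect to the Lebesgue measure for all $t\ge0$.
   Context: Spatial dimension $d=1$. Let $n\in\mathbb{N}$, $m_1,\ldots,m_n>0$, $p_1,\ldots,p_n>0$, $E\in\mathbb{R}$ be fixed. Admissible interaction potential: a map $W:\mathbb{R}\to\mathbb{R}^{n\times n}$ such that $W(z)$ is a symmetric matrix for each $z$; $W_{ij}\in C^1(\mathbb{R};\mathbb{R})$ for all $i,j$; $W(z)=W(-z)$ for all $z$; there is a matrix $\overline W\in\mathbb{R}^{n\times n}$ with $|W_{ij}(z)|\le\overline W_{ij}(1+|z|^2)$ for all $z,i,j$; and there is a symmetric matrix $\kappa\in\mathbb{R}^{n\times n}$ such that $z\mapsto W_{ij}(z)-\frac12\kappa_{ij}|z|^2$ is convex for all $i,j$. Interaction system: $\partial_t\mu_i=\partial_x\big[m_i\mu_i\,\partial_x\big(\sum_{j=1}^nW_{ij}*\mu_j\big)\big]$, $i=1,\ldots,n$; it holds in the sense of distributions if for all $i$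 and all $\varphi\in C_c^\infty((0,\infty)\times\mathbb{R})$: $\int_0^\infty\int_{\mathbb{R}}\big(\partial_t\varphi(t,x)-m_i\partial_x\varphi(t,x)\sum_{j=1}^n\int W_{ij}'(x-y)\,\mathrm{d}\mu_j(t,y)\big)\mathrm{d}\mu_i(t,x)\,\mathrm{d}t=0$. $\mathscr{P}$ is the set of $n$-tuples $\mu=(\mu_1,\ldots,\mu_n)$ of nonnegative Borel measures on $\mathbb{R}$ with $\mu_j(\mathbb{R})=p_j$, finite second moments, and $\sum_{j=1}^n\frac1{m_j}\int_{\mathbb{R}}x\,\mathrm{d}\mu_j(x)=E$, with the distance $$\mathbf{W}_{\mathscr{P}}(\mu^0,\mu^1)=\Big[\sum_{j=1}^n\frac1{m_j}\inf\Big\{\int|x-y|^2\,\mathrm{d}\gamma_j(x,y):\gamma_j\in\Gamma(\mu^0_j,\mu^1_j)\Big\}\Big]^{1/2},$$ where $\Gamma(\mu^0_j,\mu^1_j)$ is the set of finite Borel measures on $\mathbb{R}\times\mathbb{R}$ with marginals $\mu_j^0,\mu_j^1$. $AC^2_{\mathrm{loc}}([0,\infty);(X,\mathbf{d}))$ is the set of curves $\mu:[0,\infty)\to X$ such that for each $T>0$ there is $\varphi\in L^2([0,T])$ with $\mathbf{d}(\mu(s),\mu(t))\le\int_s^t\varphi(r)\,\mathrm{d}r$ for $0\le s\le t\le T$. The gradient flow solution with initial datum $\mu^0\in\mathscr{P}$ is the (existing and unique) curve in $AC^2_{\mathrm{loc}}([0,\infty);(\mathscr{P},\mathbf{W}_{\mathscr{P}}))$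 with $\mu(0)=\mu^0$ for which the interaction system holds in the sense of distributions. *)

(* Defs.v *)
From HB Require Import structures.
From mathcomp Require Import all_boot all_order all_algebra.
From mathcomp Require Import all_classical all_reals all_analysis.

Set Implicit Arguments.
Unset Strict Implicit.
Unset Printing Implicit Defensive.

Import Order.TTheory GRing.Theory Num.Theory.
Import numFieldNormedType.Exports.

Local Open Scope classical_set_scope.
Local Open Scope ring_scope.

Notation borel_measure R := {measure set (measurableTypeR R) -> \bar R}.

Record admissible (R : realType) (n : nat) (W : R -> 'M[R]_n) : Prop := {
  admissible_sym : forall z, (W z)^T = W z ;
  admissible_derivable : forall i j z, derivable (fun z => W z i j) z 1 ;
  admissible_C1 : forall i j, continuous (derive1 (fun z => W z i j)) ;
  admissible_even : forall z, W z = W (- z) ;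
  admissible_quadratic : exists Wbar : 'M[R]_n,
    forall z i j, `|W z i j| <= Wbar i j * (1 + `|z| ^+ 2) ;
  admissible_semiconvex : exists kappa : 'M[R]_n, kappa^T = kappa /\
    forall i j, @convex_function R R^o setT
      (fun z : R => W z i j - 2^-1 * kappa i j * `|z| ^+ 2)
}.

Record in_P (R : realType) (n : nat) (m p : 'I_n -> R) (E : R)
    (mu : 'I_n -> borel_measure R) : Prop := {
  in_P_mass : forall j, mu j setT = (p j)%:E ;
  in_P_moment2 : forall j, (\int[mu j]_x (x ^+ 2)%:E < +oo)%E ;
  in_P_center : \sum_(j < n) (m j)^-1 * (\int[mu j]_x x) = E
}.

Definition couplings (R : realType) (mu0 mu1 : borel_measure R) :
    set {finite_measure set (measurableTypeR R * measurableTypeR R)%type -> \bar R} :=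
  [set gamma | forall A : set (measurableTypeR R), measurable A ->
     pushforward gamma fst A = mu0 A /\ pushforward gamma snd A = mu1 A].

(* Extended-real valued; it takes finite nonnegative values on pairs of
   elements of the set defined by in_P. *)
Definition dist_P (R : realType) (n : nat) (m : 'I_n -> R)
    (mu0 mu1 : 'I_n -> borel_measure R) : \bar R :=
  ((\sum_(j < n) ((m j)^-1)%:E *
     ereal_inf [set \int[gamma]_z (`|z.1 - z.2| ^+ 2)%:E
               | gamma in couplings (mu0 j) (mu1 j)]) `^ 2^-1)%E.

(* A curve on [0, +oo[ is represented by a function on R whose values at
   negative times are irrelevant. *)
Definition AC2_loc (R : realType) (X : Type) (S : set X) (d : X -> X -> \bar R)
    (mu : R -> X) : Prop :=
  (forall t, 0 <= t -> S (mu t)) /\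
  forall T : R, 0 < T -> exists phi : measurableTypeR R -> R,
    [/\ measurable_fun `[0, T] phi,
        (\int[lebesgue_measure]_(r in `[0%R, T]) (`|phi r| ^+ 2)%:E < +oo)%E &
        forall s t : R, 0 <= s -> s <= t -> t <= T ->
          (d (mu s) (mu t) <=
             \int[lebesgue_measure]_(r in `[s, t]) (phi r)%:E)%E].

(* Points of R * R are pairs (t, x). *)
Definition axis (R : realType) (b : bool) : R * R :=
  if b then (0, 1) else (1, 0).

Definition partials (R : realType) (s : seq bool) (phi : R * R -> R) :
    R * R -> R :=
  foldr (fun b f => 'D_(axis R b) f) phi s.

(* C^oo: all iterated partial derivatives, in any order, exist and are
   continuous. *)
Definition smooth (R : realType) (phi : R * R -> R) : Prop :=
  forall s : seq bool, continuous (partials s phi) /\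
    forall (b : bool) z, derivable (partials s phi) z (axis R b).

(* An element of C_c^oo((0, +oo) x R) is identified with its extension by zero
   to R * R. *)
Definition test_function (R : realType) (phi : R * R -> R) : Prop :=
  [/\ smooth phi,
      compact (closure [set z | phi z != 0]) &
      closure [set z | phi z != 0] `<=` [set z | 0 < z.1]].

Definition distributional_solution (R : realType) (n : nat) (m : 'I_n -> R)
    (W : R -> 'M[R]_n) (mu : R -> 'I_n -> borel_measure R) : Prop :=
  forall (i : 'I_n) (phi : R * R -> R), test_function phi ->
    \int[lebesgue_measure]_(t in `]0, +oo[) \int[mu t i]_x
      ('D_(axis R false) phi (t, x) -
       m i * 'D_(axis R true) phi (t, x) *
         \sum_(j < n) \int[mu t j]_y (derive1 (fun z => W z i j) (x - y))) = 0.

(* Measures are total functions on sets, so equality at time 0 is only required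
   on Borel sets. *)
Definition gradient_flow_solution (R : realType) (n : nat) (m p : 'I_n -> R)
    (E : R) (W : R -> 'M[R]_n) (mu0 : 'I_n -> borel_measure R)
    (mu : R -> 'I_n -> borel_measure R) : Prop :=
  [/\ AC2_loc (in_P m p E) (dist_P m) mu,
      forall i (A : set (measurableTypeR R)), measurable A ->
        mu 0 i A = mu0 i A &
      distributional_solution m W mu].

Definition supp (R : realType) (mu : borel_measure R) : set R :=
  [set x | forall U : set R, open U -> U x -> (0 < mu U)%E].

Definition is_density (R : realType) (mu : borel_measure R)
    (f : measurableTypeR R -> R) : Prop :=
  [/\ measurable_fun setT f, forall x, 0 <= f x &
      forall A, measurable A ->
        mu A = (\int[lebesgue_measure]_(x in A) (f x)%:E)%E].

(* Main.v *)
(** The velocity v(t, x) = - m_i sum_j int W_ij'(x - y) dmu_j(t, y) is Lipschitz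
    in x uniformly in t, and uniformly continuous in t because t |-> mu(t) is
    continuous for the transport distance. If the endpoints of an interval
    ]l(t), r(t)[ are affine in t and r' <= v <= l' inside it, then
    mu_i(t)(]l(t), r(t)[) is nonincreasing in t: test the equation with a time
    cutoff times e(k (x - l(t))) e(k (r(t) - x)), where e(x) = exp(-1/x) for
    0 < x and 0 otherwise. The derivative of this product of two bumps along v is
    nonpositive, and it tends to the indicator of the interval as k -> +oo.
    Following an Euler polygon of v backwards in time yields
    mu_i(t)(J) <= mu_i(0)(J') with |J'| <= exp((L + 1) t) |J| for every open
    interval J. As the initial density is bounded, mu_i(t)(J) <= C |J|, and
    Lebesgue null sets are mu_i(t)-null. *)
Require Import Defs.
From HB Require Import structures.
From mathcomp Require Import all_boot all_order all_algebra.
From mathcomp Require Import all_classical all_reals all_analysis.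
From mathcomp Require Import measurable_realfun.
From mathcomp Require Import ring lra.

Set Implicit Arguments.
Unset Strict Implicit.
Unset Printing Implicit Defensive.

Import Order.TTheory GRing.Theory Num.Theory.
Import numFieldNormedType.Exports.

Local Open Scope classical_set_scope.
Local Open Scope ring_scope.

(** The velocity is only Lipschitz in [x] and continuous in [t], so a bump carried along its
    characteristics would not be a C^oo test function. Affine endpoints keep the bump smooth, at the
    price that intervals are not transported exactly: the condition [br <= v <= bl] yields
    monotonicity of the mass instead of its conservation. A one-sided statement tolerates errors, so
    the interval may be taken slightly too wide while it is followed backwards. Its radius then
    grows at rate [L + 1], where exact characteristics would give [L]. The admissible step length
    depends on the centre and the radius of the interval, but the growth factors multiply to at most
    [exp((L + 1) t)] whatever the number of steps. Hence finitely many steps already give a constant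
    common to all intervals, which is what covers of null sets by intervals of uncontrolled size
    require, and no limit of polygons is taken. *)

(** * Flat exponentials and their derivatives *)

Section FlatExponential.
Context {R : realType}.
Implicit Types (x : R) (n : nat).

(* The factors x^-n make the family stable under differentiation. *)
Definition flat_exp n x : R :=
  if 0 < x then x ^- n * expR (- x^-1) else 0.

Lemma flat_exp_le0 n x : x <= 0 -> flat_exp n x = 0.
Proof. by rewrite /flat_exp ltNge => ->. Qed.

Lemma flat_exp_gt0 n x : 0 < x -> 0 < flat_exp n x.
Proof.
by move=> x0; rewrite /flat_exp x0 mulr_gt0 ?expR_gt0// invr_gt0 exprn_gt0.
Qed.

Lemma flat_exp_ge0 n x : 0 <= flat_exp n x.
Proof.
have [/flat_exp_gt0/ltW//|/flat_exp_le0->//] := ltP 0 x.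
Qed.

(** Put [u = 1/x] in [1 + u^(n+1)/(n+1)! <= exp u]. The linear bound is what makes the derivative at
    0 vanish. *)
Lemma flat_exp_lin n x : 0 <= x -> flat_exp n x <= n.+1`!%:R * x.
Proof.
rewrite le_eqVlt => /predU1P[<-|x0]; first by rewrite flat_exp_le0// mulr0.
rewrite /flat_exp x0 expRN ler_pdivrMr ?expR_gt0//.
have xV : 0 <= x^-1 by rewrite invr_ge0 ltW.
have h : x^-1 ^+ n.+1 <= n.+1`!%:R * expR x^-1.
  rewrite mulrC -ler_pdivrMr ?ltr0n ?fact_gt0//.
  apply: le_trans (expR_ge1Dxn n xV).
  by rewrite lerDr.
rewrite -exprVn mulrAC -ler_pdivrMr// -exprSr//.
Qed.

Lemma flat_exp_le n x : flat_exp n x <= n`!%:R.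
Proof.
have [x0|/flat_exp_le0->//] := ltP 0 x.
rewrite /flat_exp x0 expRN ler_pdivrMr ?expR_gt0//.
have xV : 0 <= x^-1 by rewrite invr_ge0 ltW.
case: n => [|n].
  by rewrite expr0 invr1 fact0 mul1r (le_trans _ (expR_ge1Dx _))// lerDl.
rewrite -exprVn mulrC -ler_pdivrMr ?ltr0n ?fact_gt0//.
apply: le_trans (expR_ge1Dxn n xV).
by rewrite lerDr.
Qed.

Lemma is_derive_flat_exp n x :
  is_derive x 1 (flat_exp n) (flat_exp n.+2 x - n%:R * flat_exp n.+1 x).
Proof.
have [x0|x0|->] := ltgtP x 0.
- rewrite !flat_exp_le0 ?(ltW x0)// mulr0 subrr.
  apply: (@near_eq_is_derive _ _ _ (cst 0)).
    near=> y; rewrite flat_exp_le0//; apply: ltW; near: y; exact: lt_nbhsl.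
- rewrite /flat_exp x0.
  have xn0 : x != 0 by rewrite gt_eqF.
  pose g y : R := y^-1 ^+ n * expR (- y^-1).
  apply: (@near_eq_is_derive _ _ _ g).
    near=> y; have -> : 0 < y by near: y; exact: lt_nbhsr.
    by rewrite /g exprVn.
  have dV : is_derive x 1 (@GRing.inv R) (- x ^- 2).
    have := @derivableV R R id x 1 xn0 (@derivable_id _ _ _ _).
    move=> d; apply: DeriveDef => //.
    have := @deriveV R R id x 1 xn0 (@derivable_id _ _ _ _).
    by rewrite derive_id => ->; rewrite /GRing.scale /= mulr1.
  have dE : is_derive x 1 (fun y : R => expR (- y^-1)) (expR (- x^-1) * x ^- 2).
    apply: (@is_derive1_comp _ expR (fun y => - y^-1)).
    by rewrite -[X in is_derive _ _ _ X]opprK; exact: is_deriveN.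
  have dX := @is_deriveX _ _ _ n x 1 _ dV.
  have := @is_deriveM _ _ _ _ _ _ _ _ dX dE.
  rewrite (_ : ((fun x0 => x0^-1) ^+ n : R -> R) = fun y => y^-1 ^+ n); last first.
    by apply/funext => y; rewrite fctE.
  move=> h; apply: is_derive_eq h _.
  rewrite /GRing.scale /=.
  have -> : x ^- n.+2 = x^-1 ^+ n * x^-1 ^+ 2 by rewrite -exprVn -exprD addn2.
  rewrite -![x ^- _]exprVn; case: n {g dX} => [|n] /=.
    by rewrite /= !mulr0n; ring.
  by rewrite /= !(exprS x^-1); ring.
- rewrite !flat_exp_le0// mulr0 subrr.
  (* Dividing by [h] raises the index: the difference quotient at 0 is [flat_exp n.+1 h], which the
     linear bound squeezes to 0. *)
  have cv : (fun h : R => h^-1 *: (flat_exp n (h *: 1 + 0) - flat_exp n 0))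
      @ 0^' --> (0 : R).
    apply: (squeeze_cvgr (f := cst 0) (h := fun h => n.+2`!%:R * `|h|)).
    + near=> h.
      have hE : h^-1 *: (flat_exp n (h *: 1 + 0) - flat_exp n 0) = flat_exp n.+1 h.
        rewrite (flat_exp_le0 n (lexx 0)) subr0 addr0 /GRing.scale /= mulr1.
        rewrite /flat_exp; case: ifPn => _; last by rewrite mulr0.
        by rewrite mulrA exprS invfM.
      rewrite hE; rewrite flat_exp_ge0 /=.
      have [h0|h0] := leP h 0.
        by rewrite flat_exp_le0// mulr_ge0.
      by rewrite gtr0_norm// flat_exp_lin// ltW.
    + exact: cvg_cst.
    + rewrite -[X in _ --> X](mulr0 (n.+2`!%:R)).
      apply: cvgM; first exact: cvg_cst.
      have : (fun h : R => `|h|) @ 0^' --> `|0 : R|.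
        by apply: cvg_norm; apply: cvg_within_filter; exact: cvg_id.
      by rewrite normr0.
  apply: DeriveDef; first by apply/cvg_ex; exists 0.
  by apply/cvg_lim.
Unshelve. all: by end_near. Qed.

Lemma continuous_flat_exp n : continuous (flat_exp n).
Proof.
move=> x; apply/differentiable_continuous/derivable1_diffP.
by have := is_derive_flat_exp n x.
Qed.

End FlatExponential.

(** * Smooth functions of time and space built from flat exponentials *)

Section AffineComposition.
Context {R : realType}.

(** Along the line [h *: v + z] the argument of [g] is [h * k + y], so the one-variable chain rule
    at [h = 0] gives the directional derivative. *)
Lemma is_derive_affine (g : R -> R) (g' a b c : R) (z v : R * R) :
  is_derive (a * z.1 + b * z.2 + c) 1 g g' ->
  is_derive z v (fun w : R * R => g (a * w.1 + b * w.2 + c))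
    ((a * v.1 + b * v.2) * g').
Proof.
move=> dg; set k := a * v.1 + b * v.2; set y := a * z.1 + b * z.2 + c.
have gE (h : R) : g (a * (h *: v + z).1 + b * (h *: v + z).2 + c) =
    (g \o (fun h => h * k + y)) h.
  by rewrite /= /k /y /GRing.scale /=; congr g; ring.
have daff : is_derive (0 : R) 1 (fun h : R => h * k + y) k.
  rewrite (_ : (fun h : R => h * k + y) = id * cst k + cst y)//.
  by apply: is_derive_eq; rewrite /GRing.scale /=; ring.
have dg0 : is_derive ((fun h : R => h * k + y) 0) 1 g g'.
  by rewrite mul0r add0r.
have [dc cE] := @is_derive1_comp R g (fun h : R => h * k + y) 0 _ _ dg0 daff.
have limE : (fun h : R => h^-1 *:
    ((fun w : R * R => g (a * w.1 + b * w.2 + c)) (h *: v + z) -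
     (fun w : R * R => g (a * w.1 + b * w.2 + c)) z)) =
  (fun h : R => h^-1 *: ((g \o (fun h => h * k + y)) (h *: 1 + 0) -
     (g \o (fun h => h * k + y)) 0)).
  apply/funext => h; rewrite gE addr0 [_ *: 1]mulr1; congr (_ *: (_ - _)).
  by rewrite /= mul0r add0r.
split; first by rewrite /derivable limE.
by rewrite /derive limE mulrC -cE.
Qed.

Lemma continuous_affine2 (a b c : R) :
  continuous (fun w : R * R => a * w.1 + b * w.2 + c).
Proof.
move=> z; apply: cvgD; last exact: cvg_cst.
by apply: cvgD; apply: cvgM; [exact: cvg_cst|exact: cvg_fst|exact: cvg_cst|exact: cvg_snd].
Qed.

End AffineComposition.

Section FlatAlgebra.
Context {R : realType}.
Implicit Types f g : R * R -> R.

(* Closed under partial derivatives, which is why its members are smooth. *)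
Inductive flat_algebra : (R * R -> R) -> Prop :=
| flat_algebra_cst (c : R) : flat_algebra (fun=> c)
| flat_algebra_exp n (a b c : R) :
    flat_algebra (fun z => flat_exp n (a * z.1 + b * z.2 + c))
| flat_algebraD f g : flat_algebra f -> flat_algebra g ->
    flat_algebra (fun z => f z + g z)
| flat_algebraM f g : flat_algebra f -> flat_algebra g ->
    flat_algebra (fun z => f z * g z)
| flat_algebraV f : (forall z, 0 < f z) -> flat_algebra f ->
    flat_algebra (fun z => (f z)^-1).

Lemma flat_algebraB f g : flat_algebra f -> flat_algebra g ->
  flat_algebra (fun z => f z - g z).
Proof.
move=> hf hg; have := flat_algebraD hf (flat_algebraM (flat_algebra_cst (-1)) hg).
by congr flat_algebra; apply/funext => z; rewrite mulN1r.
Qed.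

Lemma flat_algebra_continuous f : flat_algebra f -> continuous f.
Proof.
elim=> {f} [c|n a b c|f g _ cf _ cg|f g _ cf _ cg|f f0 _ cf] z.
- exact: cvg_cst.
- apply: (@continuous_comp _ _ _ (fun w : R * R => a * w.1 + b * w.2 + c)).
    exact: continuous_affine2.
  exact: continuous_flat_exp.
- by apply: cvgD; [exact: cf|exact: cg].
- by apply: cvgM; [exact: cf|exact: cg].
- by apply: cvgV; [rewrite gt_eqF|exact: cf].
Qed.

(** Induction on the construction. Differentiating [flat_exp n] only raises the index, and the
    positivity required by [flat_algebraV] keeps [- f' / f^2] inside the algebra. *)
Lemma flat_algebra_derive f v : flat_algebra f ->
  exists2 f', flat_algebra f' & forall z, is_derive z v f (f' z).
Proof.
elim=> {f} [c|n a b c|f g hf [f' hf' df] hg [g' hg' dg]|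
  f g hf [f' hf' df] hg [g' hg' dg]|f f0 hf [f' hf' df]].
- exists (fun=> 0); first exact: flat_algebra_cst.
  by move=> z; exact: is_derive_cst.
- exists (fun z => (a * v.1 + b * v.2) *
      (flat_exp n.+2 (a * z.1 + b * z.2 + c) -
        n%:R * flat_exp n.+1 (a * z.1 + b * z.2 + c))).
    apply: flat_algebraM; first exact: flat_algebra_cst.
    apply: flat_algebraB; first exact: flat_algebra_exp.
    by apply: flat_algebraM; [exact: flat_algebra_cst|exact: flat_algebra_exp].
  by move=> z; apply: is_derive_affine; exact: is_derive_flat_exp.
- exists (fun z => f' z + g' z); first exact: flat_algebraD.
  by move=> z; exact: is_deriveD.
- exists (fun z => f z * g' z + g z * f' z).
    by apply: flat_algebraD; exact: flat_algebraM.
  by move=> z; exact: is_deriveM.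
- exists (fun z => -1 * ((f z)^-1 * (f z)^-1 * f' z)).
    apply: flat_algebraM; first exact: flat_algebra_cst.
    apply: flat_algebraM => //.
    by apply: flat_algebraM; exact: flat_algebraV.
  move=> z; have fz0 : f z != 0 by rewrite gt_eqF.
  have [d dE] := df z; split; first exact: derivableV.
  by rewrite deriveV// dE /GRing.scale /= mulN1r expr2 invfM mulNr.
Qed.

Lemma flat_algebra_smooth f : flat_algebra f -> smooth f.
Proof.
move=> hf s; have hs : flat_algebra (partials s f).
  elim: s => //= b s ih; have [g hg dg] := flat_algebra_derive (axis R b) ih.
  by rewrite (_ : 'D_(axis R b) _ = g)//; apply/funext => z; case: (dg z).
split; first exact: flat_algebra_continuous.
by move=> b z; have [g _ dg] := flat_algebra_derive (axis R b) hs; case: (dg z).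
Qed.

End FlatAlgebra.

(** * A smooth transition from 0 to 1 *)

Section SmoothStep.
Context {R : realType}.
Implicit Types x : R.

(** The classical smooth transition function on [[0, 1]]. Since [x] and [1 - x] are never both
    nonpositive, the denominator is positive everywhere. *)
Definition smooth_step x : R :=
  flat_exp 0 x / (flat_exp 0 x + flat_exp 0 (1 - x)).

(** The quotient rule after [flat_exp 2 x * flat_exp 0 x] has cancelled; in this form every term is
    nonnegative. *)
Definition smooth_step' x : R :=
  (flat_exp 2 x * flat_exp 0 (1 - x) + flat_exp 0 x * flat_exp 2 (1 - x)) /
  (flat_exp 0 x + flat_exp 0 (1 - x)) ^+ 2.

Lemma smooth_step_den_gt0 x : 0 < flat_exp 0 x + flat_exp 0 (1 - x).
Proof.
have [x0|x0] := ltP 0 x.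
  by rewrite ltr_pwDl ?flat_exp_gt0 ?flat_exp_ge0.
by rewrite ltr_pwDr ?flat_exp_ge0 ?flat_exp_gt0// subr_gt0 (le_lt_trans x0).
Qed.

Lemma smooth_step_le0 x : x <= 0 -> smooth_step x = 0.
Proof. by move=> x0; rewrite /smooth_step (flat_exp_le0 _ x0) mul0r. Qed.

Lemma smooth_step_ge1 x : 1 <= x -> smooth_step x = 1.
Proof.
move=> x1; rewrite /smooth_step (@flat_exp_le0 _ _ (1 - x)) ?subr_le0//.
by rewrite addr0 divff// gt_eqF// flat_exp_gt0// (lt_le_trans ltr01).
Qed.

Lemma smooth_step_ge0 x : 0 <= smooth_step x.
Proof. by rewrite divr_ge0 ?flat_exp_ge0// ltW// smooth_step_den_gt0. Qed.

Lemma smooth_step_le1 x : smooth_step x <= 1.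
Proof.
by rewrite ler_pdivrMr ?smooth_step_den_gt0// mul1r lerDl flat_exp_ge0.
Qed.

Lemma smooth_step'_ge0 x : 0 <= smooth_step' x.
Proof.
by rewrite divr_ge0 ?sqr_ge0// addr_ge0// mulr_ge0// flat_exp_ge0.
Qed.

Lemma smooth_step'_le0 x : x <= 0 -> smooth_step' x = 0.
Proof.
by move=> x0; rewrite /smooth_step' !(flat_exp_le0 _ x0) !mul0r addr0 mul0r.
Qed.

Lemma smooth_step'_ge1 x : 1 <= x -> smooth_step' x = 0.
Proof.
rewrite -subr_le0 => x1.
by rewrite /smooth_step' !(flat_exp_le0 _ x1) !mulr0 addr0 mul0r.
Qed.

Lemma is_derive_smooth_step x : is_derive x 1 smooth_step (smooth_step' x).
Proof.
have d1 := is_derive_flat_exp 0 x.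
have daff : is_derive x 1 (fun y : R => 1 - y) (-1).
  rewrite (_ : (fun y : R => 1 - y) = cst 1 - id)//.
  by apply: is_derive_eq; rewrite sub0r.
have d2 := @is_derive1_comp R (flat_exp 0) (fun y : R => 1 - y) x _ _
  (is_derive_flat_exp 0 (1 - x)) daff.
have d3 := is_deriveD d1 d2.
have den0 := smooth_step_den_gt0 x.
have d4 : is_derive x 1 (fun y => (flat_exp 0 y + flat_exp 0 (1 - y))^-1)
  (- (flat_exp 0 x + flat_exp 0 (1 - x)) ^- 2 * (flat_exp 2 x - flat_exp 2 (1 - x))).
  have [d dE] := d3.
  split; first by apply: derivableV => //; rewrite gt_eqF.
  have := deriveV (f := flat_exp 0 \+ (flat_exp 0 \o (fun y => 1 - y))) (x := x)
    (v := 1) _ d.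
  rewrite gt_eqF// => /(_ isT) ->; rewrite dE /GRing.scale /=; ring.
have := @is_deriveM _ _ _ _ _ _ _ _ d1 d4.
move=> h; apply: is_derive_eq h _.
rewrite /GRing.scale /smooth_step' /=.
field; rewrite gt_eqF//.
Qed.

Lemma continuous_smooth_step' : continuous smooth_step'.
Proof.
have cf n x : {for x, continuous (fun y : R => flat_exp n (1 - y))}.
  apply: (@continuous_comp _ _ _ (fun y : R => 1 - y)).
    by apply: cvgB; [exact: cvg_cst|exact: cvg_id].
  exact: continuous_flat_exp.
move=> x; apply: cvgM.
  by apply: cvgD; apply: cvgM; rewrite //; (exact: continuous_flat_exp || exact: cf).
apply: cvgV; first by rewrite expf_neq0// gt_eqF// smooth_step_den_gt0.
have cd : {for x, continuous (fun y : R => flat_exp 0 y + flat_exp 0 (1 - y))}.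
  by apply: cvgD; [exact: continuous_flat_exp|exact: cf].
by rewrite expr2; under eq_fun do rewrite expr2; exact: cvgM.
Qed.

Lemma flat_algebra_step (a b c : R) :
  flat_algebra (fun z : R * R => smooth_step (a * z.1 + b * z.2 + c)).
Proof.
have hE z : 1 - (a * z.1 + b * z.2 + c) = (- a) * z.1 + (- b) * z.2 + (1 - c) :> R.
  by ring.
apply: flat_algebraM; first exact: flat_algebra_exp.
apply: flat_algebraV; first by move=> z; exact: smooth_step_den_gt0.
apply: flat_algebraD; first exact: flat_algebra_exp.
by under eq_fun do rewrite hE; exact: flat_algebra_exp.
Qed.

End SmoothStep.

(** * Lipschitz functions integrated against finite measures and couplings *)

Section LipschitzIntegrals.
Context {R : realType}.

Lemma lipschitz_continuous (g : R -> R) (L : R) :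
  (forall x y, `|g x - g y| <= L * `|x - y|) -> continuous g.
Proof.
move=> gL x; apply/cvgrPdist_le => e e0.
have L1 : 0 < `|L| + 1 by rewrite ltr_pwDr.
near=> y; rewrite (le_trans (gL _ _))//.
rewrite (@le_trans _ _ ((`|L| + 1) * `|x - y|))//.
  by rewrite ler_wpM2r// (le_trans (ler_norm _))// lerDl.
rewrite mulrC -ler_pdivlMr//; near: y.
apply: cvgr_dist_le; first exact: cvg_id.
by rewrite divr_gt0.
Unshelve. all: by end_near. Qed.

Lemma lipschitz_measurable (g : R -> R) (L : R) :
  (forall x y, `|g x - g y| <= L * `|x - y|) ->
  measurable_fun setT (g : measurableTypeR R -> measurableTypeR R).
Proof. by move=> /lipschitz_continuous; exact: continuous_measurable_fun. Qed.

Section moment.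
Variables (nu : borel_measure R) (p : R).
Hypothesis nu_mass : nu setT = p%:E.

Lemma integrable_cst_mass (c : R) : nu.-integrable setT (EFin \o (fun=> c)).
Proof.
apply/integrableP; split; first exact/measurable_EFinP.
rewrite [X in (X < _)%E](_ : _ = \int[nu]_x (cst `|c|%:E x))%E//.
by rewrite integral_cst// nu_mass -EFinM ltry.
Qed.

Lemma bounded_integrable_mass (g : R -> R) (c : R) :
  measurable_fun setT (g : measurableTypeR R -> measurableTypeR R) ->
  (forall x, `|g x| <= c) -> nu.-integrable setT (EFin \o g).
Proof.
move=> mg gc; apply: le_integrable (integrable_cst_mass c) => //.
  exact/measurable_EFinP.
move=> x _ /=; rewrite lee_fin (le_trans (gc x))//; exact: ler_norm.
Qed.

Hypothesis nu_moment : (\int[nu]_x (x ^+ 2)%:E < +oo)%E.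

(** Since [|x| <= 1 + x^2], the function is dominated by [|g 0| + L + L x^2], which finite mass and
    second moment make integrable. *)
Lemma lipschitz_integrable (g : R -> R) (L : R) : 0 <= L ->
  (forall x y, `|g x - g y| <= L * `|x - y|) ->
  nu.-integrable setT (EFin \o g).
Proof.
move=> L0 gL.
have mX : measurable_fun setT (fun x : measurableTypeR R => x ^+ 2 : measurableTypeR R).
  by apply: continuous_measurable_fun => x; exact: exprn_continuous.
have iX : nu.-integrable setT (EFin \o (fun x : R => x ^+ 2)).
  apply/integrableP; split; first exact/measurable_EFinP.
  apply: le_lt_trans nu_moment; under eq_integral do rewrite /= ger0_norm ?sqr_ge0//.
  by [].
have ig : nu.-integrable setT
    ((EFin \o (fun=> `|g 0%R| + L)%R) \+ (fun x => L%:E * (EFin \o (fun x : R => x ^+ 2)%R) x))%E.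
  apply: integrableD => //; first exact: integrable_cst_mass.
  exact: integrableZl.
apply: le_integrable ig => //.
  by apply/measurable_EFinP; exact: lipschitz_measurable gL.
move=> x _ /=; rewrite lee_fin.
apply: le_trans (ler_norm _).
have := gL x 0; rewrite subr0 => gx.
have gx0 : `|g x| <= `|g 0| + L * `|x|.
  rewrite -lerBlDl; exact: le_trans (lerB_dist _ _) gx.
have x2 : `|x| <= 1 + x ^+ 2 by rewrite -[x ^+ 2]real_normK ?num_real//; nra.
rewrite (le_trans gx0)// -addrA lerD2l.
by rewrite (le_trans (ler_wpM2l L0 x2))// mulrDr mulr1.
Qed.

End moment.

(** A change of variables. [couplings] fixes the marginals on Borel sets only, so the passage to the
    pushforward compares integrals, not measures as functions. *)
Lemma integral_coupling_fst (mu0 mu1 : borel_measure R) gamma (g : R -> R) :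
  couplings mu0 mu1 gamma ->
  measurable_fun setT (g : measurableTypeR R -> measurableTypeR R) ->
  mu0.-integrable setT (EFin \o g) ->
  gamma.-integrable setT (EFin \o (g \o fst)) /\
  \int[mu0]_x g x = \int[gamma]_z g z.1.
Proof.
move=> cg mg ig.
have mE (h : R -> \bar R) :
    (\int[mu0]_x h x = \int[pushforward gamma fst]_x h x)%E.
  by apply: eq_measure_integral => A mA _; case: (cg A mA).
have igf : gamma.-integrable setT ((EFin \o g) \o fst).
  apply/integrableP; split.
    by apply: measurableT_comp; [exact/measurable_EFinP|exact: measurable_fst].
  have /integrableP[_] := ig; rewrite mE ge0_integral_pushforward//.
  by apply: measurableT_comp => //; exact/measurable_EFinP.
split => //.
rewrite /Rintegral mE integral_pushforward//.
exact/measurable_EFinP.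
Qed.

Lemma integral_coupling_snd (mu0 mu1 : borel_measure R) gamma (g : R -> R) :
  couplings mu0 mu1 gamma ->
  measurable_fun setT (g : measurableTypeR R -> measurableTypeR R) ->
  mu1.-integrable setT (EFin \o g) ->
  gamma.-integrable setT (EFin \o (g \o snd)) /\
  \int[mu1]_x g x = \int[gamma]_z g z.2.
Proof.
move=> cg mg ig.
have mE (h : R -> \bar R) :
    (\int[mu1]_x h x = \int[pushforward gamma snd]_x h x)%E.
  by apply: eq_measure_integral => A mA _; case: (cg A mA).
have igf : gamma.-integrable setT ((EFin \o g) \o snd).
  apply/integrableP; split.
    by apply: measurableT_comp; [exact/measurable_EFinP|exact: measurable_snd].
  have /integrableP[_] := ig; rewrite mE ge0_integral_pushforward//.
  by apply: measurableT_comp => //; exact/measurable_EFinP.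
split => //.
rewrite /Rintegral mE integral_pushforward//.
exact/measurable_EFinP.
Qed.

(* The bound |u| <= e + u^2 / e, with e free, replaces the Cauchy-Schwarz
   inequality. *)
Lemma coupling_lipschitz (mu0 mu1 : borel_measure R) gamma (p c e L : R)
    (g : R -> R) :
  mu0 setT = p%:E -> mu1 setT = p%:E ->
  (\int[mu0]_x (x ^+ 2)%:E < +oo)%E -> (\int[mu1]_x (x ^+ 2)%:E < +oo)%E ->
  couplings mu0 mu1 gamma ->
  (\int[gamma]_z (`|z.1 - z.2| ^+ 2)%:E <= c%:E)%E ->
  0 < e -> 0 <= L -> (forall x y, `|g x - g y| <= L * `|x - y|) ->
  `|\int[mu0]_x g x - \int[mu1]_x g x| <= L * (e * p + c / e).
Proof.
move=> mass0 mass1 mom0 mom1 cg gc e0 L0 gL.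
have mg := lipschitz_measurable gL.
have [i1 ->] := integral_coupling_fst cg mg (lipschitz_integrable mass0 mom0 L0 gL).
have [i2 ->] := integral_coupling_snd cg mg (lipschitz_integrable mass1 mom1 L0 gL).
rewrite -RintegralB//.
have i12 : gamma.-integrable setT
    (EFin \o (fun z : measurableTypeR R * measurableTypeR R => g z.1 - g z.2)).
  exact: (integrableB measurableT i1 i2).
rewrite (le_trans (le_normr_Rintegral measurableT i12))//.
have massg : gamma setT = p%:E.
  by rewrite -mass0; case: (cg setT measurableT) => <- _; rewrite /pushforward preimage_setT.
have mz : measurable_fun setT
    (fun z : measurableTypeR R * measurableTypeR R => `|z.1 - z.2| ^+ 2 : R).
  apply: measurable_funX; apply: measurableT_comp => //.
  by apply: measurable_funB; [exact: measurable_fst|exact: measurable_snd].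
have lt : (\int[gamma]_z (`|(g z.1 - g z.2)%R|)%:E <=
           \int[gamma]_z ((L * e)%:E + (L / e)%:E * (`|z.1 - z.2| ^+ 2)%:E))%E.
  apply: ge0_le_integral => //.
  - by apply/measurable_EFinP/measurableT_comp => //; have /measurable_int/measurable_EFinP := i12.
  - apply: emeasurable_funD => //; apply: emeasurable_funM => //.
    exact/measurable_EFinP.
  - move=> z _; rewrite -EFinM -EFinD lee_fin (le_trans (gL _ _))//.
    rewrite -!mulrA -mulrDr ler_wpM2l//.
    have d0 := normr_ge0 (z.1 - z.2); set u := `|_| in d0 *.
    rewrite -(ler_pM2r e0) mulrDl -(mulrC (u ^+ 2)) mulfVK ?gt_eqF//.
    nra.
rewrite -lee_fin /Rintegral fineK; last first.
  rewrite ge0_fin_numE ?integral_ge0//.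
  by have /integrableP[_ h] := i12; exact: h.
have c0 : forall z : R * R, (0 <= (L * e)%:E)%E.
  by move=> z; rewrite lee_fin mulr_ge0// ltW.
have s0 : forall z : R * R, (0 <= (`|z.1 - z.2| ^+ 2)%:E)%E.
  by move=> z; rewrite lee_fin sqr_ge0.
have k0 : (0 <= (L / e)%:E)%E by rewrite lee_fin divr_ge0// ltW.
have mEz : measurable_fun setT
    (fun z : measurableTypeR R * measurableTypeR R => (`|z.1 - z.2| ^+ 2)%:E).
  exact/measurable_EFinP.
have mk : measurable_fun setT
    (fun z : measurableTypeR R * measurableTypeR R =>
      (L / e)%:E * (`|z.1 - z.2| ^+ 2)%:E)%E.
  exact: emeasurable_funM.
have splitE : (\int[gamma]_z ((L * e)%:E + (L / e)%:E * (`|z.1 - z.2| ^+ 2)%:E) =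
    (L * e)%:E * p%:E + (L / e)%:E * \int[gamma]_z (`|z.1 - z.2| ^+ 2)%:E)%E.
  rewrite -massg -(integral_cst gamma measurableT (L * e)%:E).
  rewrite -(ge0_integralZl gamma measurableT mEz (fun z _ => s0 z) k0).
  apply: ge0_integralD => //.
  - by move=> z _; exact: (c0 (0, 0)).
  - by move=> z _; exact: mule_ge0 (s0 z).
rewrite (le_trans lt)// splitE.
have -> : L * (e * p + c / e) = L * e * p + L / e * c by ring.
by rewrite EFinD !EFinM leeD2l// lee_wpmul2l.
Qed.

End LipschitzIntegrals.

(** * Continuity in time of the curve of measures *)

Section CurveContinuity.
Context {R : realType} {n : nat}.
Variables (m p : 'I_n -> R) (E : R).
Hypothesis m_gt0 : forall j, 0 < m j.
Hypothesis p_gt0 : forall j, 0 < p j.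

(** All summands of the squared distance are nonnegative, so each one is below [e ^+ 2]. The strict
    inequality leaves room for a coupling that is merely close to the infimum. *)
Lemma dist_P_coupling (mu0 mu1 : 'I_n -> borel_measure R) (e : R) j :
  0 < e -> (dist_P m mu0 mu1 < e%:E)%E ->
  exists2 gamma, couplings (mu0 j) (mu1 j) gamma &
    (\int[gamma]_z (`|z.1 - z.2| ^+ 2)%:E <= (m j * e ^+ 2)%:E)%E.
Proof.
move=> e0; pose F k := (((m k)^-1)%:E *
  ereal_inf [set \int[gamma]_z (`|z.1 - z.2| ^+ 2)%:E
            | gamma in couplings (mu0 k) (mu1 k)])%E.
rewrite /dist_P -/(\sum_(k < n) F k)%E.
have F0 k : (0 <= F k)%E.
  apply: mule_ge0; first by rewrite lee_fin invr_ge0 ltW.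
  apply: le_ereal_inf_tmp => _ [gamma _ <-]; apply: integral_ge0 => z _.
  by rewrite lee_fin sqr_ge0.
have S0 : (0 <= \sum_(k < n) F k)%E by apply: sume_ge0.
move=> dlt.
have : (\sum_(k < n) F k < (e ^+ 2)%:E)%E.
  rewrite ltNge; apply/negP => le; move: dlt; rewrite ltNge => /negP; apply.
  have -> : e%:E = ((e ^+ 2)%:E `^ 2^-1)%E.
    by rewrite poweR_EFin powR12_sqrt ?sqr_ge0// sqrtr_sqr gtr0_norm.
  apply: gt0_ler_poweR => //; rewrite in_itv/= leey andbT//.
  by rewrite lee_fin sqr_ge0.
have FjS : (F j <= \sum_(k < n) F k)%E.
  by rewrite (bigD1 j)//= leeDl// sume_ge0.
move=> /(le_lt_trans FjS); rewrite /F lte_pdivrMl// -EFinM.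
move=> /ereal_inf_lt[_ [gamma cg <-] /ltW h].
by exists gamma.
Qed.

Variable mu : R -> 'I_n -> borel_measure R.
Hypothesis mu_AC : AC2_loc (in_P m p E) (dist_P m) mu.

Lemma AC2_loc_modulus (T e : R) : 0 < T -> 0 < e ->
  exists2 d, 0 < d & forall s t, 0 <= s -> s <= t -> t <= T -> t - s < d ->
    (dist_P m (mu s) (mu t) <= e%:E)%E.
Proof.
move=> T0 e0; have [_ /(_ T T0)[phi [mphi phi2 dphi]]] := mu_AC.
have mphi2 : measurable_fun `[0, T] (fun r => (`|phi r| ^+ 2)%:E : \bar R).
  by apply/measurable_EFinP; apply: measurable_funX; apply: measurableT_comp.
set I := (\int[lebesgue_measure]_(r in `[0%R, T]) (`|phi r| ^+ 2)%:E)%E in phi2.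
have I0 : (0 <= I)%E by apply: integral_ge0 => r _; rewrite lee_fin sqr_ge0.
have [C IE] : exists C, I = C%:E.
  by exists (fine I); rewrite fineK// ge0_fin_numE.
have C0 : 0 <= C by rewrite -lee_fin -IE.
(* From [|phi| <= K + phi^2 / K], the distance is at most [K (t - s) + C / K]. This [K] makes the
   second term at most [e / 2], and the choice of [d] below does so for the first; [C + 1] keeps [K]
   positive when [C = 0]. *)
pose K := 2 * (C + 1) / e.
have K0 : 0 < K by rewrite divr_gt0// mulr_gt0// ltr_wpDl.
exists (e / 2 / K); first by rewrite divr_gt0// divr_gt0.
move=> s t s0 st tT ts; apply: le_trans (dphi _ _ s0 st tT) _.
have sub : `[s, t]%classic `<=` `[0, T]%classic.
  move=> r /=; rewrite !in_itv/= => /andP[sr rt].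
  by rewrite (le_trans s0 sr) (le_trans rt tT).
have mI : measurable `[0, T]%classic by [].
have mphist : measurable_fun `[s, t] (EFin \o phi).
  by apply/measurable_EFinP; apply: measurable_funS mphi.
apply: le_trans (lee_abs _) _.
apply: le_trans (le_abse_integral lebesgue_measure (measurable_itv _) mphist) _.
have mphi2st := measurable_funS mI sub mphi2.
have k0 : (0 <= (K^-1)%:E)%E by rewrite lee_fin invr_ge0 ltW.
apply: (@le_trans _ _ (\int[lebesgue_measure]_(r in `[s, t])
    (K%:E + (K^-1)%:E * (`|phi r| ^+ 2)%:E))%E).
  apply: ge0_le_integral => //=.
  - by apply/measurable_EFinP; apply: measurableT_comp => //; apply: measurable_funS mphi.
  - by apply: emeasurable_funD => //; apply: emeasurable_funM.
  - move=> r _; rewrite -EFinM -EFinD lee_fin.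
    have u0 := normr_ge0 (phi r); set u := `|phi r| in u0 *.
    rewrite -(ler_pM2l K0) mulrDr mulrA divff ?gt_eqF// mul1r; nra.
have lenE : lebesgue_measure `[s, t]%classic = (t - s)%:E.
  rewrite lebesgue_measure_itv/= lte_fin.
  by move: st; rewrite le_eqVlt => /predU1P[->|->//]; rewrite ltxx subrr.
have -> : (\int[lebesgue_measure]_(r in `[s, t])
    (K%:E + (K^-1)%:E * (`|phi r| ^+ 2)%:E) =
    K%:E * (t - s)%:E +
    (K^-1)%:E * \int[lebesgue_measure]_(r in `[s, t]) (`|phi r| ^+ 2)%:E)%E.
  rewrite ge0_integralD//.
  - rewrite (integral_cst lebesgue_measure (measurable_itv _) K%:E).
    congr (_ * _ + _)%E; first exact: lenE.
    by rewrite ge0_integralZl// => r _; rewrite lee_fin sqr_ge0.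
  - by move=> r _; rewrite lee_fin ltW.
  - by move=> r _; rewrite -EFinM lee_fin mulr_ge0 ?sqr_ge0// invr_ge0 ltW.
  - exact: emeasurable_funM.
have leI : (\int[lebesgue_measure]_(r in `[s, t]) (`|phi r| ^+ 2)%:E <= C%:E)%E.
  rewrite -IE; apply: ge0_subset_integral => //.
apply: le_trans (leeD (lexx _) (lee_wpmul2l k0 leI)) _.
rewrite -!EFinM -EFinD lee_fin.
have h1 : K * (t - s) <= e / 2.
  by rewrite mulrC -ler_pdivlMr// ltW.
have h2 : K^-1 * C <= e / 2.
  rewrite /K mulrC ler_pdivrMr// -[leRHS]mulrA.
  have -> : 2^-1 * (2 * (C + 1) / e) = (C + 1) / e by field; rewrite gt_eqF.
  by rewrite mulrC divfK ?gt_eqF// lerDl.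
by rewrite [leRHS](splitr e) lerD.
Qed.

(** The same [d] serves every [g] and [j]. Applied to all the translates of one Lipschitz kernel, it
    gives a modulus in time that is uniform in space. *)
Lemma curve_lipschitz_modulus (T e : R) : 0 < T -> 0 < e ->
  exists2 d, 0 < d & forall s t, 0 <= s <= T -> 0 <= t <= T -> `|s - t| < d ->
    forall j (g : R -> R) (L : R), 0 <= L ->
      (forall x y, `|g x - g y| <= L * `|x - y|) ->
      `|\int[mu s j]_x g x - \int[mu t j]_x g x| <= L * e.
Proof.
move=> T0 e0.
(* With [a] as the free parameter of the coupling estimate and cost at most [m j * a ^+ 2], the
   error is [L * a * (p j + m j)], at most [L * a * C = L * e]. *)
pose C := \sum_(j < n) (p j + m j) + 1.
have C0 : 0 < C by rewrite ltr_wpDl// sumr_ge0// => j _; rewrite addr_ge0 ?ltW.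
pose a := e / C.
have a0 : 0 < a by rewrite divr_gt0.
(* Asking for [a / 2] turns the weak bound on the distance into the strict one that yields a
   coupling. *)
have [d d0 dd] := AC2_loc_modulus T0 (divr_gt0 a0 (ltr0n R 2)).
have main s t : 0 <= s -> s <= t -> t <= T -> t - s < d ->
    forall j (g : R -> R) (L : R), 0 <= L ->
      (forall x y, `|g x - g y| <= L * `|x - y|) ->
      `|\int[mu s j]_x g x - \int[mu t j]_x g x| <= L * e.
  move=> s0 st tT ts j g L L0 gL.
  have dlt : (dist_P m (mu s) (mu t) < a%:E)%E.
    apply: le_lt_trans (dd s t s0 st tT ts) _.
    by rewrite lte_fin ltr_pdivrMr// ltr_pMr// ltr1n.
  have [gamma cg gle] := dist_P_coupling j a0 dlt.
  have [mu_P _] := mu_AC.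
  have [mass0 mom0 _] := mu_P s s0.
  have [mass1 mom1 _] := mu_P t (le_trans s0 st).
  have h := coupling_lipschitz (mass0 j) (mass1 j) (mom0 j) (mom1 j) cg gle a0 L0 gL.
  apply: le_trans h _; rewrite ler_wpM2l//.
  have -> : m j * a ^+ 2 / a = a * m j by field; rewrite gt_eqF.
  rewrite -mulrDr /a mulrAC ler_pdivrMr// ler_wpM2l ?(ltW e0)//.
  rewrite /C (bigD1 j)//= -addrA lerDl addr_ge0// sumr_ge0// => k _.
  by rewrite addr_ge0 ?ltW.
exists d => // s t /andP[s0 sT] /andP[t0 tT] st j g L L0 gL.
have [le_st|/ltW le_ts] := leP s t.
  by apply: main => //; move: st; rewrite distrC ger0_norm ?subr_ge0.
by rewrite distrC; apply: main => //; move: st; rewrite ger0_norm ?subr_ge0.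
Qed.

End CurveContinuity.

(** * Comparison of integrals of arbitrary functions *)

Section IntegralComparison.
Context d (T : measurableType d) (R : realType) (nu : {measure set T -> \bar R}).
Implicit Types D : set T.

(** The integral of a nonnegative function is a supremum over simple functions below it, and this
    supremum is monotone for arbitrary functions. *)
Lemma ge0_le_integral_nonmeasurable D (f g : T -> \bar R) :
  (forall x, D x -> 0 <= f x)%E -> (forall x, D x -> f x <= g x)%E ->
  (\int[nu]_(x in D) f x <= \int[nu]_(x in D) g x)%E.
Proof.
move=> f0 fg; have g0 x : D x -> (0 <= g x)%E.
  by move=> Dx; exact: le_trans (f0 _ Dx) (fg _ Dx).
rewrite !ge0_integralE//; apply: ereal_sup_le => _ [h /= hf <-].
exists h => // x; apply: le_trans (hf x) _.
by rewrite /patch; case: ifPn => //; rewrite inE => /fg.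
Qed.

(* f need not be measurable, so the measurability in t of integrals against
   mu t i never has to be proved. *)
Lemma Rintegral_le_nonmeasurable D (h f g : T -> R) : measurable D ->
  nu.-integrable D (EFin \o h) -> nu.-integrable D (EFin \o g) ->
  (forall x, D x -> h x <= f x <= g x) ->
  \int[nu]_(x in D) f x <= \int[nu]_(x in D) g x.
Proof.
move=> mD ih ig hfg; rewrite /Rintegral (integralE _ _ (EFin \o f)).
rewrite (integralE _ _ (EFin \o g)).
have fp : (\int[nu]_(x in D) (EFin \o f)^\+ x <= \int[nu]_(x in D) (EFin \o g)^\+ x)%E.
  apply: ge0_le_integral_nonmeasurable => // x Dx; have /andP[_ h2] := hfg x Dx.
  by rewrite !funeposE ge_max !le_max lexx orbT andbT lee_fin h2.
have fn : (\int[nu]_(x in D) (EFin \o g)^\- x <= \int[nu]_(x in D) (EFin \o f)^\- x)%E.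
  apply: ge0_le_integral_nonmeasurable => // x Dx; have /andP[_ h2] := hfg x Dx.
  by rewrite !funenegE ge_max !le_max lexx orbT andbT lee_fin lerN2 h2.
(* [fine] sends infinite values to 0, so it is monotone only between finite integrals; the minorant
   [h] keeps the negative part of [f] finite. *)
have hn : (\int[nu]_(x in D) (EFin \o f)^\- x <= \int[nu]_(x in D) (EFin \o h)^\- x)%E.
  apply: ge0_le_integral_nonmeasurable => // x Dx; have /andP[h2 _] := hfg x Dx.
  by rewrite !funenegE ge_max !le_max lexx orbT andbT lee_fin lerN2 h2.
have gpoo := integrable_pos_fin_num mD ig.
have gnoo := integrable_neg_fin_num mD ig.
have hnoo := integrable_neg_fin_num mD ih.
have finf (x y : \bar R) : (0 <= x)%E -> (x <= y)%E -> y \is a fin_num -> x \is a fin_num.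
  move=> x0 xy fy; rewrite ge0_fin_numE// (le_lt_trans xy)//.
  by rewrite -(ge0_fin_numE (le_trans x0 xy)).
have fpoo : (\int[nu]_(x in D) (EFin \o f)^\+ x)%E \is a fin_num.
  by apply: finf fp gpoo; exact: integral_ge0.
have fnoo : (\int[nu]_(x in D) (EFin \o f)^\- x)%E \is a fin_num.
  by apply: finf hn hnoo; exact: integral_ge0.
apply: fine_le; [by rewrite fin_numB fpoo fnoo|by rewrite fin_numB gpoo gnoo|].
exact: leeB.
Qed.

End IntegralComparison.

(** * Regularity of the velocity field *)

Section Velocity.
Context {R : realType} {n : nat}.
Variables (m p : 'I_n -> R) (E : R) (W : R -> 'M[R]_n).
Variables (mu : R -> 'I_n -> borel_measure R) (i : 'I_n).
Hypothesis m_gt0 : forall j, 0 < m j.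
Hypothesis p_gt0 : forall j, 0 < p j.
Hypothesis mu_AC : AC2_loc (in_P m p E) (dist_P m) mu.
Hypothesis W'_lipschitz : forall j, lipschitz (derive1 (fun z => W z i j)).

Definition velocity (t x : R) : R :=
  - (m i * \sum_(j < n) \int[mu t j]_y (derive1 (fun z => W z i j) (x - y))).

Lemma lipschitz_W' : exists2 L, 0 <= L &
  forall j x y, `|derive1 (fun z => W z i j) x - derive1 (fun z => W z i j) y| <=
    L * `|x - y|.
Proof.
have /choice[K KP] : forall j, exists K, 0 <= K /\
    forall x y, `|derive1 (fun z => W z i j) x - derive1 (fun z => W z i j) y| <=
      K * `|x - y|.
  move=> j; have [M [Mr MP]] := W'_lipschitz j.
  (* [lipschitz] says that every constant beyond some [M] works; this one is also nonnegative. *)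
  exists (`|M| + 1); split; first by rewrite addr_ge0.
  move=> x y; apply: (MP (`|M| + 1) _ (x, y)) => //.
  by rewrite (le_lt_trans (ler_norm _))// ltrDl.
exists (\sum_(j < n) K j); first by rewrite sumr_ge0// => j _; case: (KP j).
move=> j x y; case: (KP j) => Kj0 /(_ x y)/le_trans; apply.
rewrite ler_wpM2r// (bigD1 j)//= lerDl sumr_ge0// => k _; by case: (KP k).
Qed.

(** The constant involves [mu t] only through the masses [p j], which do not change in time. *)
Lemma velocity_lipschitz : exists2 L, 0 <= L &
  forall t x y, 0 <= t -> `|velocity t x - velocity t y| <= L * `|x - y|.
Proof.
have [K K0 KP] := lipschitz_W'.
exists (m i * \sum_(j < n) K * p j).
  apply: mulr_ge0; first exact: ltW.
  by apply: sumr_ge0 => j _; apply: mulr_ge0 => //; exact: ltW.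
move=> t x y t0; rewrite /velocity -opprD normrN -mulrBr normrM gtr0_norm//.
rewrite -mulrA ler_wpM2l ?(ltW (m_gt0 i))// mulr_suml -sumrB.
apply: le_trans (ler_norm_sum _ _ _) _; apply: ler_sum => j _.
have [mu_P _] := mu_AC; have [mass mom _] := mu_P t t0.
have lip z : forall u w, `|derive1 (fun z => W z i j) (z - u) -
    derive1 (fun z => W z i j) (z - w)| <= K * `|u - w|.
  move=> u w; apply: le_trans (KP j _ _) _.
  by rewrite (_ : z - u - (z - w) = - (u - w)) ?normrN//; ring.
have int z := lipschitz_integrable (mass j) (mom j) K0 (lip z).
rewrite -RintegralB//.
have intB : (mu t j).-integrable setT (EFin \o (fun u =>
    derive1 (fun z => W z i j) (x - u) - derive1 (fun z => W z i j) (y - u))).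
  exact: (integrableB measurableT (int x) (int y)).
apply: le_trans (le_normr_Rintegral _ intB) _ => //.
have -> : K * p j * `|x - y| = \int[mu t j]_u (K * `|x - y|).
  by rewrite Rintegral_cst// (mass j) /= mulrAC.
apply: le_Rintegral => //.
- exact: integrable_norm.
- exact: integrable_cst_mass (mass j) _.
- move=> u _; apply: le_trans (KP j _ _) _.
  by rewrite (_ : x - u - (y - u) = x - y)//; ring.
Qed.

(** All the kernels [y |-> W_ij'(x - y)] share one Lipschitz constant, hence the modulus in time
    does not depend on [x]. *)
Lemma velocity_modulus (T e : R) : 0 < T -> 0 < e ->
  exists2 d, 0 < d & forall s t x, 0 <= s <= T -> 0 <= t <= T -> `|s - t| < d ->
    `|velocity s x - velocity t x| <= e.
Proof.
move=> T0 e0; have [K K0 KP] := lipschitz_W'.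
pose C := m i * (n%:R * K) + 1.
have C0 : 0 < C by rewrite ltr_wpDl// mulr_ge0 ?(ltW (m_gt0 i))// mulr_ge0.
have [d d0 dP] := curve_lipschitz_modulus m_gt0 p_gt0 mu_AC T0 (divr_gt0 e0 C0).
exists d => // s t x sT tT st.
rewrite /velocity -opprD normrN -mulrBr normrM gtr0_norm// -sumrB.
apply: (@le_trans _ _ (m i * \sum_(j < n) (K * (e / C)))).
  rewrite ler_wpM2l ?(ltW (m_gt0 i))//.
  apply: le_trans (ler_norm_sum _ _ _) _; apply: ler_sum => j _.
  apply: dP => // u w; apply: le_trans (KP j _ _) _.
  by rewrite (_ : x - u - (x - w) = - (u - w)) ?normrN//; ring.
rewrite sumr_const card_ord -mulr_natl.
have -> : m i * (n%:R * (K * (e / C))) = (C - 1) * (e / C) by rewrite /C; ring.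
by rewrite mulrA ler_pdivrMr// mulrC ler_wpM2l ?(ltW e0)// gerBl.
Qed.

End Velocity.

(** * Bumps on moving intervals *)

Section FlatExpZero.
Context {R : realType}.
Implicit Types x y : R.

(** Mean value theorem: the derivative is [flat_exp 2], which lies between 0 and 2!. *)
Lemma flat_exp0_increment x y : y <= x ->
  0 <= flat_exp 0 x - flat_exp 0 y <= 2 * (x - y).
Proof.
move=> yx.
have [c _ ->] : exists2 c, c \in `[y, x] &
    flat_exp 0 x - flat_exp 0 y = (flat_exp 2 c - 0 * flat_exp 1 c) * (x - y).
  apply: (@MVT_segment R (flat_exp 0) (fun c => flat_exp 2 c - 0 * flat_exp 1 c)) => //.
    by move=> z _; exact: is_derive_flat_exp.
  by apply: continuous_subspaceT; exact: continuous_flat_exp.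
rewrite mul0r subr0 mulr_ge0 ?flat_exp_ge0 ?subr_ge0//=.
by rewrite ler_wpM2r ?subr_ge0// (flat_exp_le 2).
Qed.

Lemma flat_exp0_le x y : y <= x -> flat_exp 0 y <= flat_exp 0 x.
Proof. by move=> /flat_exp0_increment/andP[]; rewrite subr_ge0. Qed.

Lemma flat_exp0_lipschitz x y :
  `|flat_exp 0 x - flat_exp 0 y| <= 2 * `|x - y|.
Proof.
wlog yx : x y / y <= x => [hw|].
  have [/hw//|/ltW/hw] := leP y x.
  by rewrite distrC (distrC y).
have /andP[h0 h1] := flat_exp0_increment yx.
by rewrite (ger0_norm h0) ger0_norm ?subr_ge0.
Qed.

Lemma flat_exp0_le1 x : flat_exp 0 x <= 1.
Proof. by have := flat_exp_le 0 x; rewrite fact0. Qed.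

End FlatExpZero.

Section MovingBump.
Context {R : realType}.
Variables k cl bl cr br : R.

(** The two factors vanish beyond the left and the right endpoint. Separate indices are carried
    because differentiating the bump of indices 0, 0 produces those of indices 2, 0 and 0, 2. *)
Definition moving_bump (nl nr : nat) (t x : R) : R :=
  flat_exp nl (k * (x - (cl + bl * t))) * flat_exp nr (k * (cr + br * t - x)).

Lemma bump_ge0 nl nr t x : 0 <= moving_bump nl nr t x.
Proof. by rewrite mulr_ge0// flat_exp_ge0. Qed.

Lemma bump_le nl nr t x : moving_bump nl nr t x <= nl`!%:R * nr`!%:R.
Proof. by rewrite ler_pM ?flat_exp_ge0// flat_exp_le. Qed.

Lemma bump_neq0 nl nr t x : 0 < k -> moving_bump nl nr t x != 0 ->
  cl + bl * t < x < cr + br * t.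
Proof.
move=> k0; rewrite mulf_eq0 negb_or => /andP[h1 h2]; apply/andP; split.
  rewrite ltNge; apply: contra h1 => h; rewrite flat_exp_le0//.
  by rewrite pmulr_rle0// subr_le0.
rewrite ltNge; apply: contra h2 => h; rewrite flat_exp_le0//.
by rewrite pmulr_rle0// subr_le0.
Qed.

Lemma bump00_lipschitz s t x y : 0 < k ->
  `|moving_bump 0 0 s x - moving_bump 0 0 t y| <=
    4 * k * `|x - y| + 2 * k * (`|bl| + `|br|) * `|s - t|.
Proof.
move=> k0; rewrite /moving_bump.
set A := flat_exp 0 (k * (x - _)); set B := flat_exp 0 (k * (_ - x)).
set A' := flat_exp 0 (k * (y - _)); set B' := flat_exp 0 (k * (_ - y)).
have hA : `|A - A'| <= 2 * k * (`|x - y| + `|bl| * `|s - t|).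
  apply: le_trans (flat_exp0_lipschitz _ _) _.
  rewrite -mulrBr normrM gtr0_norm// mulrA ler_wpM2l ?mulr_ge0 ?(ltW k0)//.
  rewrite (_ : x - (cl + bl * s) - _ = (x - y) - bl * (s - t)); last by ring.
  by rewrite -normrM ler_normB.
have hB : `|B - B'| <= 2 * k * (`|x - y| + `|br| * `|s - t|).
  apply: le_trans (flat_exp0_lipschitz _ _) _.
  rewrite -mulrBr normrM gtr0_norm// mulrA ler_wpM2l ?mulr_ge0 ?(ltW k0)//.
  rewrite (_ : cr + br * s - x - _ = br * (s - t) - (x - y)); last by ring.
  by rewrite -normrM [leRHS]addrC ler_normB.
have -> : A * B - A' * B' = (A - A') * B + A' * (B - B') by ring.
apply: le_trans (ler_normD _ _) _; rewrite !normrM.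
have B1 : `|B| <= 1 by rewrite ger0_norm ?flat_exp_ge0 ?flat_exp0_le1.
have A1 : `|A'| <= 1 by rewrite ger0_norm ?flat_exp_ge0 ?flat_exp0_le1.
have h1 : `|A - A'| * `|B| <= `|A - A'| by rewrite ler_piMr.
have h2 : `|A'| * `|B - B'| <= `|B - B'| by rewrite ler_piMl.
lra.
Qed.

Lemma continuous_bump nl nr t : continuous (moving_bump nl nr t).
Proof.
move=> x; apply: cvgM.
  apply: (@continuous_comp _ _ _ (fun x => k * (x - (cl + bl * t)))).
    by apply: cvgM; [exact: cvg_cst|apply: cvgB; [exact: cvg_id|exact: cvg_cst]].
  exact: continuous_flat_exp.
apply: (@continuous_comp _ _ _ (fun x => k * (cr + br * t - x))).
  by apply: cvgM; [exact: cvg_cst|apply: cvgB; [exact: cvg_cst|exact: cvg_id]].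
exact: continuous_flat_exp.
Qed.

Let leftE (z : R * R) : k * (z.2 - (cl + bl * z.1)) =
  (- k * bl) * z.1 + k * z.2 + (- k * cl).
Proof. by ring. Qed.

Let rightE (z : R * R) : k * (cr + br * z.1 - z.2) =
  (k * br) * z.1 + (- k) * z.2 + k * cr.
Proof. by ring. Qed.

Lemma flat_algebra_bump nl nr : flat_algebra (fun z => moving_bump nl nr z.1 z.2).
Proof.
rewrite /moving_bump; under eq_fun do rewrite leftE rightE.
by apply: flat_algebraM; exact: flat_algebra_exp.
Qed.

(** In the direction [(1, w)] the two coefficients are [k (w - bl)] and [k (br - w)], both
    nonpositive exactly when [br <= w <= bl]. *)
Lemma is_derive_bump00 (z v : R * R) :
  is_derive z v (fun w => moving_bump 0 0 w.1 w.2)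
    (k * (v.2 - bl * v.1) * moving_bump 2 0 z.1 z.2 +
     k * (br * v.1 - v.2) * moving_bump 0 2 z.1 z.2).
Proof.
rewrite /moving_bump; under eq_fun do rewrite leftE rightE.
rewrite leftE rightE.
have d1 := is_derive_affine v (is_derive_flat_exp 0 ((- k * bl) * z.1 + k * z.2 + (- k * cl))).
have d2 := is_derive_affine v (is_derive_flat_exp 0 ((k * br) * z.1 + (- k) * z.2 + k * cr)).
have := @is_deriveM _ _ _ _ _ _ _ _ d1 d2.
move=> h; apply: is_derive_eq h _; rewrite /GRing.scale /=; ring.
Qed.

End MovingBump.

(** * Time cutoffs and test functions *)

Section TimeCutoff.
Context {R : realType}.
Variables a b h : R.
Hypothesis h0 : 0 < h.
Hypothesis ahb : a + h <= b.

(** For [a + h <= b] this rises on [[a, a + h]] and falls on [[b, b + h]], so the two signs of its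
    derivative occur in separate time windows. *)
Definition cutoff (t : R) : R := smooth_step ((t - a) / h) - smooth_step ((t - b) / h).

Definition cutoff' (t : R) : R := (smooth_step' ((t - a) / h) - smooth_step' ((t - b) / h)) / h.

Lemma cutoff_ge0 t : 0 <= cutoff t.
Proof.
rewrite subr_ge0; have [tb|bt] := leP t b.
  by rewrite (@smooth_step_le0 _ ((t - b) / h)) ?smooth_step_ge0// pmulr_lle0 ?invr_gt0// subr_le0.
rewrite (@smooth_step_ge1 _ ((t - a) / h)) ?smooth_step_le1//.
by rewrite ler_pdivlMr// mul1r lerBrDl (le_trans ahb)// ltW.
Qed.

Lemma cutoff_le1 t : cutoff t <= 1.
Proof. by rewrite lerBlDr (le_trans (smooth_step_le1 _))// lerDl smooth_step_ge0. Qed.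

Lemma cutoff_out t : t <= a \/ b + h <= t -> cutoff t = 0.
Proof.
rewrite /cutoff => -[ta|bt].
  rewrite !smooth_step_le0 ?subrr// pmulr_lle0 ?invr_gt0// subr_le0//.
  by rewrite (le_trans ta)// (le_trans _ ahb)// lerDl ltW.
rewrite !smooth_step_ge1 ?subrr// ler_pdivlMr// mul1r lerBrDr addrC//.
by rewrite (le_trans ahb)// (le_trans _ bt)// lerDl ltW.
Qed.

Let stepE c (z : R * R) : (z.1 - c) / h = h^-1 * z.1 + 0 * z.2 + (- c / h).
Proof. by ring. Qed.

Lemma flat_algebra_cutoff : flat_algebra (fun z => cutoff z.1).
Proof.
rewrite /cutoff; under eq_fun do rewrite !stepE.
by apply: flat_algebraB; exact: flat_algebra_step.
Qed.

Lemma is_derive_cutoff (z v : R * R) :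
  is_derive z v (fun w => cutoff w.1) (v.1 * cutoff' z.1).
Proof.
rewrite /cutoff /cutoff'; under eq_fun do rewrite !stepE.
rewrite !stepE.
have d1 := is_derive_affine v (is_derive_smooth_step (h^-1 * z.1 + 0 * z.2 + (- a / h))).
have d2 := is_derive_affine v (is_derive_smooth_step (h^-1 * z.1 + 0 * z.2 + (- b / h))).
have := is_deriveB d1 d2.
by move=> e; apply: is_derive_eq e _; rewrite /=; ring.
Qed.

End TimeCutoff.

Lemma smooth_step'_bounded (R : realType) :
  exists2 C : R, 0 <= C & forall x, smooth_step' x <= C.
Proof.
have [c _ cP] := @EVT_max R smooth_step' 0 1 ler01
  (continuous_subspaceT (@continuous_smooth_step' R)).
exists (smooth_step' c); first exact: smooth_step'_ge0.
move=> x; have [x0|x0] := leP x 0.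
  by rewrite smooth_step'_le0// smooth_step'_ge0.
have [x1|x1] := leP x 1; first by apply: cP; rewrite in_itv/= (ltW x0).
by rewrite smooth_step'_ge1 ?smooth_step'_ge0// ltW.
Qed.

Lemma test_function_bump (R : realType) (k cl bl cr br a b h : R) :
  0 < k -> 0 < h -> 0 < a -> a + h <= b ->
  test_function (fun z => cutoff a b h z.1 * moving_bump k cl bl cr br 0 0 z.1 z.2).
Proof.
move=> k0 h0 a0 ahb; set f := (X in test_function X).
(* Both endpoints stay in [[- M, M]] for all times between 0 and [b + h]. *)
pose M := `|cl| + `|cr| + (`|bl| + `|br|) * (b + h).
pose K : set (R * R) := `[a, b + h]%classic `*` `[- M, M]%classic.
have cK : compact K by apply: compact_setX; exact: segment_compact.
have supp_sub : closure [set z | f z != 0] `<=` K.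
  have /closure_id -> : closed K by apply: compact_closed cK; exact: norm_hausdorff.
  apply: closure_subset => -[t x] /=; rewrite /f mulf_eq0 negb_or /= => /andP[ct bt].
  have /andP[lx xr] := bump_neq0 k0 bt.
  have tab : a <= t <= b + h.
    rewrite !leNgt -negb_or; apply: contra ct => /orP ht; apply/eqP.
    by apply: cutoff_out => //; case: ht => /ltW; [left|right].
  split; rewrite /= in_itv/= ?tab//.
  have /andP[at_ tb] := tab.
  have t0 : 0 <= t by rewrite (le_trans (ltW a0)).
  have hl : `|bl * t| <= `|bl| * (b + h) by rewrite normrM ler_wpM2l// ger0_norm.
  have hr : `|br * t| <= `|br| * (b + h) by rewrite normrM ler_wpM2l// ger0_norm.
  have := ler_norm (- cl); have := ler_norm (- (bl * t)); rewrite !normrN.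
  have := ler_norm cr; have := ler_norm (br * t).
  have := normr_ge0 cl; have := normr_ge0 cr.
  have := normr_ge0 (bl * t); have := normr_ge0 (br * t).
  rewrite /M => *; lra.
split.
- apply: flat_algebra_smooth; apply: flat_algebraM.
    exact: flat_algebra_cutoff.
  exact: flat_algebra_bump.
- by apply: subclosed_compact cK supp_sub; exact: closed_closure.
- move=> [t x] /supp_sub[/=]; rewrite in_itv/= => /andP[at_ _] _.
  exact: lt_le_trans at_.
Qed.

(** * Monotonicity of the mass seen by a bump *)

Section Transport.
Context {R : realType} {n : nat}.
Variables (m p : 'I_n -> R) (E : R) (W : R -> 'M[R]_n).
Variables (mu : R -> 'I_n -> borel_measure R) (i : 'I_n).
Hypothesis m_gt0 : forall j, 0 < m j.
Hypothesis p_gt0 : forall j, 0 < p j.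
Hypothesis mu_AC : AC2_loc (in_P m p E) (dist_P m) mu.
Hypothesis W'_lipschitz : forall j, lipschitz (derive1 (fun z => W z i j)).
Hypothesis mu_sol : distributional_solution m W mu.

Notation v := (velocity m W mu i).

Section moving_interval.
Variables a b k cl bl cr br : R.
Hypothesis a_ge0 : 0 <= a.
Hypothesis ab : a < b.
Hypothesis k0 : 0 < k.
Hypothesis v_between : forall t, a < t < b ->
  forall x, cl + bl * t < x < cr + br * t -> br <= v t x <= bl.

Notation psi := (moving_bump k cl bl cr br).

Definition bump_mass (t : R) : R := \int[mu t i]_x psi 0 0 t x.

Let mass t : 0 <= t -> mu t i setT = (p i)%:E.
Proof. by move=> t0; have [mu_P _] := mu_AC; have [+ _ _] := mu_P t t0. Qed.

Let psi_measurable nl nr t :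
  measurable_fun setT (psi nl nr t : measurableTypeR R -> measurableTypeR R).
Proof. by apply: continuous_measurable_fun; exact: continuous_bump. Qed.

Let psi_norm nl nr t x : `|psi nl nr t x| <= nl`!%:R * nr`!%:R.
Proof. by rewrite ger0_norm ?bump_ge0 ?bump_le. Qed.

Let psi_integrable nl nr s t : 0 <= t ->
  (mu t i).-integrable setT (EFin \o psi nl nr s).
Proof.
move=> t0.
refine (bounded_integrable_mass (mass t0) (psi_measurable nl nr s) (psi_norm nl nr s)).
Qed.

Lemma bump_mass_continuous (e : R) : 0 < e ->
  exists2 d, 0 < d & forall s t, 0 <= s <= b -> 0 <= t <= b -> `|s - t| < d ->
    `|bump_mass s - bump_mass t| <= e.
Proof.
move=> e0; have b0 : 0 < b by exact: le_lt_trans ab.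
pose K := 2 * k * (`|bl| + `|br|) * p i + 1.
have K0 : 0 < K.
  by rewrite ltr_wpDl// !mulr_ge0// ?(ltW k0)// ?addr_ge0// ltW.
have [d d0 dP] := curve_lipschitz_modulus m_gt0 p_gt0 mu_AC b0
  (divr_gt0 e0 (mulr_gt0 (ltr0n R 8) k0)).
exists (Num.min d (e / 2 / K)); first by rewrite lt_min d0 divr_gt0// divr_gt0.
move=> s t /andP[s0 sb] /andP[t0 tb]; rewrite lt_min => /andP[std stK].
(* The bump moves under a fixed measure, then the measure moves under a fixed bump. The latter is
   [4 * k]-Lipschitz in space, whence the [8 * k] above. *)
have -> : bump_mass s - bump_mass t =
    (\int[mu s i]_x psi 0 0 s x - \int[mu s i]_x psi 0 0 t x) +
    (\int[mu s i]_x psi 0 0 t x - \int[mu t i]_x psi 0 0 t x).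
  by rewrite /bump_mass; ring.
apply: le_trans (ler_normD _ _) _; rewrite [e]splitr; apply: lerD.
- rewrite -RintegralB//; [|exact: psi_integrable|exact: psi_integrable].
  have iB : (mu s i).-integrable setT (EFin \o (fun x => psi 0 0 s x - psi 0 0 t x)).
    exact: (integrableB measurableT (psi_integrable 0 0 s s0) (psi_integrable 0 0 t s0)).
  apply: le_trans (le_normr_Rintegral measurableT iB) _.
  apply: (@le_trans _ _ (\int[mu s i]_x (2 * k * (`|bl| + `|br|) * `|s - t|))).
    apply: le_Rintegral => //; first exact: integrable_norm.
      exact: integrable_cst_mass (mass s0) _.
    move=> x _; apply: le_trans (bump00_lipschitz _ _ _ _ _ _ _ _ k0) _.
    by rewrite subrr normr0 mulr0 add0r.
  rewrite Rintegral_cst// mass//=.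
  have : K * `|s - t| <= e / 2 by rewrite mulrC -ler_pdivlMr// ltW.
  apply: le_trans; rewrite mulrAC ler_wpM2r// /K; lra.
- have L0 : 0 <= 4 * k by rewrite mulr_ge0// ltW.
  have lip x y : `|psi 0 0 t x - psi 0 0 t y| <= 4 * k * `|x - y|.
    apply: le_trans (bump00_lipschitz _ _ _ _ _ _ _ _ k0) _.
    by rewrite subrr normr0 mulr0 addr0.
  have := dP s t _ _ std i _ _ L0 lip; rewrite s0 sb t0 tb => /(_ isT isT).
  move=> /le_trans; apply.
  have -> : 4 * k * (e / (8 * k)) = e / 2 by field; rewrite gt_eqF.
  by [].
Qed.

Lemma velocity_continuous t : 0 <= t -> continuous (v t).
Proof.
move=> t0; have [L L0 LP] := velocity_lipschitz m_gt0 p_gt0 mu_AC W'_lipschitz.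
by apply: (@lipschitz_continuous _ _ L) => x y; exact: LP.
Qed.

(** The integrand of the weak equation for [c t * psi 0 0 t x]; the sign in [velocity] turns the
    equation into a derivative along [(1, v)]. The second summand is nonpositive for [c t >= 0]. *)
Let q (c c' : R -> R) (t : R) (x : R) : R :=
  c' t * psi 0 0 t x +
  c t * k * (psi 2 0 t x * (v t x - bl) + psi 0 2 t x * (br - v t x)).

Let sol_q a1 b1 h : 0 < h -> 0 < a1 -> a1 + h <= b1 ->
  \int[lebesgue_measure]_(t in `]0, +oo[)
    \int[mu t i]_x q (cutoff a1 b1 h) (cutoff' a1 b1 h) t x = 0.
Proof.
move=> h0 a10 ahb.
have tf := test_function_bump cl bl cr br k0 h0 a10 ahb.
rewrite -[RHS](mu_sol i tf); apply: eq_Rintegral => t _.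
apply: eq_Rintegral => x _.
have dP (w : R * R) : is_derive (t, x) w
    (fun z => cutoff a1 b1 h z.1 * psi 0 0 z.1 z.2)
    (cutoff a1 b1 h t * (k * (w.2 - bl * w.1) * psi 2 0 t x +
       k * (br * w.1 - w.2) * psi 0 2 t x) +
     psi 0 0 t x * (w.1 * cutoff' a1 b1 h t)).
  exact: (is_deriveM (is_derive_cutoff a1 b1 h (t, x) w)
    (is_derive_bump00 k cl bl cr br (t, x) w)).
rewrite /axis; have [_ ->] := dP (1, 0); have [_ ->] := dP (0, 1).
rewrite /q /velocity /=; set S := \sum_(j < n) _; ring.
Qed.

Let q_out a1 b1 h t x : 0 < h -> a1 + h <= b1 -> t <= a1 \/ b1 + h <= t ->
  q (cutoff a1 b1 h) (cutoff' a1 b1 h) t x = 0.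
Proof.
move=> h0 ahb ht; rewrite /q cutoff_out// !mul0r addr0 /cutoff'.
have -> : smooth_step' ((t - a1) / h) - smooth_step' ((t - b1) / h) = 0.
  case: ht => ht.
    rewrite !smooth_step'_le0 ?subrr// pmulr_lle0 ?invr_gt0// subr_le0//.
    by rewrite (le_trans ht)// (le_trans _ ahb)// lerDl ltW.
  rewrite !smooth_step'_ge1 ?subrr// ler_pdivlMr// mul1r lerBrDr addrC//.
  by rewrite (le_trans ahb)// (le_trans _ ht)// lerDl ltW.
by rewrite !mul0r.
Qed.

Let q_le c c' t x : a < t < b -> 0 <= c t -> q c c' t x <= c' t * psi 0 0 t x.
Proof.
move=> tab c0; rewrite /q gerDl mulr_ge0_le0 ?mulr_ge0 ?(ltW k0)//.
rewrite -(addr0 0) lerD//.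
  have [->|/(bump_neq0 k0)/(v_between tab)/andP[_ h]] := eqVneq (psi 2 0 t x) 0.
    by rewrite mul0r.
  by rewrite mulr_ge0_le0 ?bump_ge0// subr_le0.
have [->|/(bump_neq0 k0)/(v_between tab)/andP[h _]] := eqVneq (psi 0 2 t x) 0.
  by rewrite mul0r.
by rewrite mulr_ge0_le0 ?bump_ge0// subr_le0.
Qed.

(** A crude bound whose purpose is a constant minorant for the comparison of time integrals. Inside
    the interval [|v - bl|] and [|br - v|] are at most [|bl - br|], and each bump derivative is at
    most 2!. *)
Let q_norm c c' t x : a < t < b -> 0 <= c t <= 1 ->
  `|q c c' t x| <= `|c' t| + 4 * k * `|bl - br|.
Proof.
move=> tab /andP[c0 c1]; rewrite /q.
have h1 : `|psi 2 0 t x * (v t x - bl)| <= 2 * `|bl - br|.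
  have [->|/(bump_neq0 k0)/(v_between tab)/andP[h h']] := eqVneq (psi 2 0 t x) 0.
    by rewrite mul0r normr0 mulr_ge0.
  rewrite normrM ler_pM//; first by have := psi_norm 2 0 t x; rewrite fact0 mulr1.
  rewrite distrC !ger0_norm ?subr_ge0 ?(le_trans h h')//.
  by rewrite lerD2l lerN2.
have h2 : `|psi 0 2 t x * (br - v t x)| <= 2 * `|bl - br|.
  have [->|/(bump_neq0 k0)/(v_between tab)/andP[h h']] := eqVneq (psi 0 2 t x) 0.
    by rewrite mul0r normr0 mulr_ge0.
  rewrite normrM ler_pM//; first by have := psi_norm 0 2 t x; rewrite fact0 mul1r.
  rewrite distrC !ger0_norm ?subr_ge0 ?(le_trans h h')//.
  by rewrite lerD2r.
apply: le_trans (ler_normD _ _) _; apply: lerD.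
  rewrite normrM ler_piMr//.
  by have := psi_norm 0 0 t x; rewrite fact0 mulr1.
rewrite !normrM (ger0_norm c0) (gtr0_norm k0).
apply: (@le_trans _ _ (1 * k * (2 * `|bl - br| + 2 * `|bl - br|))).
  rewrite ler_pM ?mulr_ge0 ?(ltW k0)//; first by rewrite ler_wpM2r ?(ltW k0).
  by apply: le_trans (ler_normD _ _) _; exact: lerD.
by rewrite le_eqVlt; apply/orP; left; apply/eqP; ring.
Qed.

Let q_measurable c c' t : 0 <= t ->
  measurable_fun setT (q c c' t : measurableTypeR R -> measurableTypeR R).
Proof.
move=> t0; apply: continuous_measurable_fun => x.
have cv := velocity_continuous t0; have cp nl nr := @continuous_bump R k cl bl cr br nl nr t.
apply: cvgD; first by apply: cvgM; [exact: cvg_cst|exact: cp].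
apply: cvgM; first exact: cvg_cst.
apply: cvgD; apply: cvgM; try exact: cp.
  by apply: cvgB; [exact: cv|exact: cvg_cst].
by apply: cvgB; [exact: cvg_cst|exact: cv].
Qed.

Lemma bump_mass_nonincreasing : bump_mass b <= bump_mass a.
Proof.
rewrite leNgt; apply/negP => Gab.
(* A cutoff rising from 0 to 1 just after a, where bump_mass <= alpha, and falling
   back just before b, where bump_mass >= beta > alpha, turns the equation into
   0 <= alpha - beta. *)
pose e := (bump_mass b - bump_mass a) / 3.
have e0 : 0 < e by rewrite divr_gt0// subr_gt0.
have [d d0 dP] := bump_mass_continuous e0.
(* [d / 4] keeps both cutoff windows within [d] of [a] and of [b]; [(b - a) / 4] makes the rising
   window end before the falling one begins. *)
pose h := Num.min (d / 4) ((b - a) / 4).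
have h0 : 0 < h by rewrite lt_min !divr_gt0// subr_gt0.
have hd : h <= d / 4 by rewrite ge_min lexx.
have hab : h <= (b - a) / 4 by rewrite ge_min lexx orbT.
(* [a] may be 0 while test functions live at positive times, hence the start at [a + h]. The cutoff
   vanishes again from [b1 + h = b] on. *)
pose a1 := a + h; pose b1 := b - h.
have a10 : 0 < a1 by rewrite ltr_wpDl.
have ahb : a1 + h <= b1 by rewrite /a1 /b1; lra.
have b1h : b1 + h = b by rewrite /b1 subrK.
have a1b : a1 < b by rewrite /a1; lra.
pose c := cutoff a1 b1 h; pose c' := cutoff' a1 b1 h.
pose alpha := bump_mass a + e; pose beta := bump_mass b - e.
have albe : alpha < beta.
  rewrite /alpha /beta; have : 3 * e = bump_mass b - bump_mass a by rewrite /e; field.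
  lra.
(* [g] is [c' t * bump_mass t] with the mass replaced by [alpha] on the rising window and by [beta]
   on the falling one: a continuous majorant with the explicit primitive [F]. *)
pose g t := (alpha * smooth_step' ((t - a1) / h) - beta * smooth_step' ((t - b1) / h)) / h.
pose F t := alpha * smooth_step ((t - a1) / h) - beta * smooth_step ((t - b1) / h).
have [Cs Cs0 CsP] := smooth_step'_bounded R.
pose l := - ((2 * Cs / h + 4 * k * `|bl - br|) * p i).
have c'_norm t : `|c' t| <= 2 * Cs / h.
  rewrite /c' /cutoff' normrM (gtr0_norm (_ : 0 < h^-1)) ?invr_gt0//.
  rewrite ler_pM2r ?invr_gt0//; apply: le_trans (ler_normB _ _) _.
  rewrite !ger0_norm ?smooth_step'_ge0//.
  by have := CsP ((t - a1) / h); have := CsP ((t - b1) / h); lra.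
have bounds t : a < t < b -> l <= \int[mu t i]_x q c c' t x <= g t.
  move=> tab; have /andP[a_t t_b] := tab; have t0 : 0 <= t by rewrite (le_trans a_ge0)// ltW.
  have c01 : 0 <= c t <= 1 by rewrite cutoff_ge0// cutoff_le1.
  have qb x : `|q c c' t x| <= 2 * Cs / h + 4 * k * `|bl - br|.
    by apply: le_trans (q_norm c' x tab c01) _; rewrite lerD2r.
  have iq : (mu t i).-integrable setT (EFin \o q c c' t).
    refine (bounded_integrable_mass (mass t0) (q_measurable c c' t0) qb).
  apply/andP; split.
    have -> : l = \int[mu t i]_x (- (2 * Cs / h + 4 * k * `|bl - br|)).
      by rewrite Rintegral_cst// mass// /l mulNr.
    apply: le_Rintegral => //; first exact: integrable_cst_mass (mass t0) _.
    by move=> x _; have := qb x; rewrite ler_norml => /andP[].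
  have t0b : 0 <= t <= b by rewrite t0 ltW.
  apply: (@le_trans _ _ (c' t * bump_mass t)).
    rewrite /bump_mass -RintegralZl//; last exact: psi_integrable.
    apply: le_Rintegral => //.
      have := integrableZl measurableT (c' t) (psi_integrable 0 0 t t0).
      by apply: eq_integrable => // x _; rewrite /= EFinM.
    by move=> x _; apply: q_le => //; case/andP: c01.
  rewrite /c' /cutoff' /g mulrAC ler_pM2r ?invr_gt0// mulrBl; apply: lerB.
    have [ta1|a1t] := leP (a1 + h) t.
      by rewrite smooth_step'_ge1 ?mul0r ?mulr0// ler_pdivlMr// mul1r lerBrDl.
    rewrite mulrC ler_wpM2r ?smooth_step'_ge0//.
    have := dP t a t0b; rewrite a_ge0 (ltW ab) => /(_ isT).
    rewrite gtr0_norm ?subr_gt0// => /(_ _)/wrap[].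
      by rewrite ltrBlDr (lt_le_trans a1t)// /a1; lra.
    by rewrite ler_norml /alpha => /andP[_]; rewrite lerBlDl.
  have [tb1|b1t] := leP t b1.
    by rewrite smooth_step'_le0 ?mul0r ?mulr0// pmulr_lle0 ?invr_gt0// subr_le0.
  rewrite [leRHS]mulrC ler_wpM2r ?smooth_step'_ge0//.
  have := dP t b t0b; rewrite lexx (ltW (le_lt_trans a_ge0 ab)) => /(_ isT).
  rewrite ltr0_norm ?subr_lt0// => /(_ _)/wrap[].
    by move: b1t; rewrite /b1; lra.
  by rewrite ler_norml /beta => /andP[+ _]; lra.
(* The bounds on the velocity are assumed only before [b]; at [b] itself the cutoff and its
   derivative vanish. *)
have bounds_b t : t = b -> l <= \int[mu t i]_x q c c' t x <= g t.
  move=> ->; have -> : \int[mu b i]_x q c c' b x = 0.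
    rewrite /Rintegral integral0_eq// => x _.
    by rewrite /c /c' q_out//; right; rewrite b1h.
  have -> : g b = 0.
    rewrite /g !smooth_step'_ge1 ?mulr0 ?subrr ?mul0r// ler_pdivlMr// mul1r.
      by rewrite lerBrDl -b1h lerD2r.
    by rewrite lerBrDl (le_trans ahb)// /b1 gerBl ltW.
  rewrite lexx andbT oppr_le0 mulr_ge0 ?(ltW (p_gt0 i))// addr_ge0//.
    by rewrite divr_ge0 ?(ltW h0)// mulr_ge0.
  by rewrite !mulr_ge0// ltW.
have dF (t : R) : is_derive t 1 F (g t).
  have daff (y : R) : is_derive t 1 (fun t : R => (t - y) / h) h^-1.
    rewrite (_ : (fun t : R => (t - y) / h) = (id - cst y) * cst h^-1)//.
    by apply: is_derive_eq; rewrite /GRing.scale /= subr0 mulr0 add0r mulr1.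
  have d1 := is_deriveZ alpha (@is_derive1_comp R smooth_step (fun t => (t - a1) / h) t _ _
    (is_derive_smooth_step _) (daff a1)).
  have d2 := is_deriveZ beta (@is_derive1_comp R smooth_step (fun t => (t - b1) / h) t _ _
    (is_derive_smooth_step _) (daff b1)).
  have := is_deriveB d1 d2.
  by move=> H; apply: is_derive_eq H _; rewrite /g /GRing.scale /=; ring.
have cF : continuous F.
  by move=> t; apply/differentiable_continuous/derivable1_diffP; case: (dF t).
have cg : continuous g.
  have cs (y : R) : continuous (fun t : R => smooth_step' ((t - y) / h)).
    move=> t; apply: (@continuous_comp _ _ _ (fun t : R => (t - y) / h)).
      by apply: cvgM; [apply: cvgB; [exact: cvg_id|exact: cvg_cst]|exact: cvg_cst].
    exact: continuous_smooth_step'.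
  move=> t; apply: cvgM; last exact: cvg_cst.
  by apply: cvgB; apply: cvgM; (exact: cvg_cst || exact: cs).
have ig : lebesgue_measure.-integrable `[a1, b] (EFin \o g).
  apply: continuous_compact_integrable; first exact: segment_compact.
  exact: continuous_subspaceT.
have il : lebesgue_measure.-integrable `[a1, b] (EFin \o (fun=> l)).
  apply: continuous_compact_integrable; first exact: segment_compact.
  by apply: continuous_subspaceT => x; exact: cvg_cst.
have qE : \int[lebesgue_measure]_(t in `[a1, b]) \int[mu t i]_x q c c' t x = 0.
  rewrite -(sol_q h0 a10 ahb) Rintegral_mkcond [RHS]Rintegral_mkcond.
  apply: eq_Rintegral => t _; rewrite /patch !mem_setE !in_itv/=.
  have [a1t|ta1] := leP a1 t; have [tb|bt] := leP t b => //=.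
  - by rewrite (lt_le_trans a10 a1t).
  - case: ifPn => // _; apply/esym; rewrite /Rintegral integral0_eq// => x _.
    by rewrite q_out//; right; rewrite b1h ltW.
  - case: ifPn => // _; apply/esym; rewrite /Rintegral integral0_eq// => x _.
    by rewrite q_out//; left; rewrite ltW.
  - case: ifPn => // _; apply/esym; rewrite /Rintegral integral0_eq// => x _.
    by rewrite q_out//; left; rewrite ltW.
have : \int[lebesgue_measure]_(t in `[a1, b]) \int[mu t i]_x q c c' t x <=
    \int[lebesgue_measure]_(t in `[a1, b]) g t.
  apply: (Rintegral_le_nonmeasurable (h := fun=> l)) => //.
  move=> t /=; rewrite in_itv/= => /andP[a1t]; rewrite le_eqVlt => /predU1P[|tb].
    exact: bounds_b.
  by apply: bounds; rewrite tb andbT (lt_le_trans _ a1t)// ltrDl.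
rewrite qE /Rintegral (@continuous_FTC2 R g F) //.
- have -> : F b = alpha - beta.
    rewrite /F !smooth_step_ge1 ?mulr1// ler_pdivlMr// mul1r.
      by rewrite lerBrDl -b1h lerD2r.
    by rewrite lerBrDl (le_trans ahb)// /b1 gerBl ltW.
  have -> : F a1 = 0.
    rewrite /F !smooth_step_le0 ?mulr0 ?subrr// pmulr_lle0 ?invr_gt0//.
    by rewrite subr_le0 (le_trans _ ahb)// lerDl ltW.
  rewrite /=; lra.
- exact: continuous_subspaceT.
- split.
  + by move=> t _; case: (dF t).
  + by apply: cvg_at_right_filter; exact: cF.
  + by apply: cvg_at_left_filter; exact: cF.
- by move=> t _; rewrite derive1E; case: (dF t).
Qed.

End moving_interval.
End Transport.

(** * From bumps to open intervals, and from these to null sets *)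

Lemma flat_exp0_cvg (R : realType) (x : R) : 0 < x ->
  flat_exp 0 (k.+1%:R * x) @[k --> \oo] --> (1 : R).
Proof.
move=> x0; apply: (squeeze_cvgr (f := fun k => 1 - x^-1 * harmonic k) (h := cst 1)).
- near=> k; rewrite /= flat_exp0_le1 andbT /flat_exp mulr_gt0// expr0 invr1 mul1r.
  by apply: le_trans (expR_ge1Dx _); rewrite invfM mulrC.
- rewrite -[X in _ --> X]subr0 -(mulr0 x^-1); apply: cvgB; first exact: cvg_cst.
  by apply: cvgM; [exact: cvg_cst|exact: cvg_harmonic].
- exact: cvg_cst.
Unshelve. all: by end_near. Qed.

(** Lebesgue outer measure is an infimum over countable covers by open intervals, so a linear bound
    on intervals passes to null sets by countable subadditivity. Dividing by [C + 1] also covers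
    [C = 0]. *)
Lemma null_dominates_open_itv (R : realType) (nu : borel_measure R) (C : R) :
  0 <= C -> (forall x y, x < y -> (nu `]x, y[%classic <= (C * (y - x))%:E)%E) ->
  nu `<< lebesgue_measure.
Proof.
move=> C0 nuC N N0 A mA AN.
have lA : (wlength idfun)^*%mu A = 0%E.
  apply/negligible_outer_measure; exists A; split => //; exact: N0.
have C1 : 0 < C + 1 by rewrite ltr_wpDl.
apply/eqP; rewrite -measure_le0; apply/lee_addgt0Pr => e e0; rewrite add0e.
have := lA; rewrite outer_measure_open_itv_cover => infA.
have : (ereal_inf [set \sum_(0 <= k <oo) wlength idfun (F k) | F in open_itv_cover A] <
    (e / (C + 1))%:E)%E by rewrite infA lte_fin divr_gt0.
move=> /ereal_inf_lt[_ [F [oF AF] <-] Fe].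
have mF k : measurable (F k : set (measurableTypeR R)).
  by have [ab ->] := oF k; exact: measurable_itv.
apply: le_trans (measure_sigma_subadditive nu mF mA AF) _.
have w0 k : (0 <= wlength idfun (F k))%E.
  by have [[x y] ->] := oF k; exact: wlength_itv_ge0.
have Fk k : (nu (F k) <= C%:E * wlength idfun (F k))%E.
  have [[x y] FE] := oF k; have [xy|yx] := ltP x y.
    by rewrite FE wlength_itv_bnd ?(ltW xy)// -EFinM; exact: nuC.
  have -> : F k = set0 by rewrite FE set_itv_ge// bnd_simp -leNgt.
  by rewrite measure0 mule_ge0 ?lee_fin// wlength0.
apply: (@le_trans _ _ (C%:E * \sum_(0 <= k <oo) wlength idfun (F k))%E).
  rewrite -nneseriesZl//; exact: lee_nneseries.
apply: (@le_trans _ _ (C%:E * (e / (C + 1))%:E)%E).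
  by apply: lee_wpmul2l; [rewrite lee_fin|exact: ltW].
rewrite -EFinM lee_fin mulrA ler_pdivrMr// mulrC ler_wpM2l ?(ltW e0)//.
by rewrite lerDl.
Qed.

Section IntervalTransport.
Context {R : realType} {n : nat}.
Variables (m p : 'I_n -> R) (E : R) (W : R -> 'M[R]_n).
Variables (mu : R -> 'I_n -> borel_measure R) (i : 'I_n).
Hypothesis m_gt0 : forall j, 0 < m j.
Hypothesis p_gt0 : forall j, 0 < p j.
Hypothesis mu_AC : AC2_loc (in_P m p E) (dist_P m) mu.
Hypothesis W'_lipschitz : forall j, lipschitz (derive1 (fun z => W z i j)).
Hypothesis mu_sol : distributional_solution m W mu.

Notation v := (velocity m W mu i).

(** The limit is taken at time [b] only, where the bumps increase to the indicator as the steepness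
    grows. At time [a] it suffices that every bump lies below the indicator. *)
Lemma interval_transport (a b cl bl cr br : R) : 0 <= a -> a < b ->
  (forall t, a < t < b ->
    forall x, cl + bl * t < x < cr + br * t -> br <= v t x <= bl) ->
  (mu b i `](cl + bl * b)%R, (cr + br * b)%R[%classic <=
   mu a i `](cl + bl * a)%R, (cr + br * a)%R[%classic)%E.
Proof.
move=> a0 ab hv; have b0 : 0 <= b by rewrite (le_trans a0)// ltW.
pose J t := `]cl + bl * t, cr + br * t[%classic : set (measurableTypeR R).
have mJ t : measurable (J t) by exact: measurable_itv.
pose psi k t x := moving_bump k.+1%:R cl bl cr br 0 0 t x.
have mass t : 0 <= t -> mu t i setT = (p i)%:E.
  by move=> t0; have [mu_P _] := mu_AC; have [+ _ _] := mu_P t t0.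
have mpsi k t : measurable_fun setT (psi k t : measurableTypeR R -> measurableTypeR R).
  by apply: continuous_measurable_fun; exact: continuous_bump.
have ipsi k t : 0 <= t -> (mu t i).-integrable setT (EFin \o psi k t).
  move=> t0; refine (bounded_integrable_mass (c := 1) (mass _ t0) (mpsi k t) _) => x.
  by rewrite ger0_norm ?bump_ge0// -[leRHS]mulr1 ler_pM ?flat_exp_ge0 ?flat_exp0_le1.
have psi_indic k t x : psi k t x <= \1_(J t) x.
  rewrite indicE; have [->|/bump_neq0 h] := eqVneq (psi k t x) 0; first by [].
  rewrite mem_set; last by rewrite /J /= in_itv/=; apply: h.
  by rewrite -[leRHS]mulr1 ler_pM ?flat_exp_ge0 ?flat_exp0_le1.
have massE k t : 0 <= t ->
    (\int[mu t i]_x (psi k t x)%:E = (bump_mass mu i k.+1%:R cl bl cr br t)%:E)%E.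
  move=> t0; rewrite /bump_mass /Rintegral fineK//.
  exact: (integrable_fin_num measurableT (ipsi k t t0)).
have upper k : (\int[mu b i]_x (psi k b x)%:E <= mu a i (J a))%E.
  apply: (@le_trans _ _ (\int[mu a i]_x (psi k a x)%:E)%E).
    rewrite !massE// lee_fin.
    exact: (bump_mass_nonincreasing m_gt0 p_gt0 mu_AC W'_lipschitz mu_sol).
  rewrite -[leRHS](_ : \int[mu a i]_x (\1_(J a) x)%:E = _)%E; last first.
    by rewrite integral_indic// setIT.
  apply: ge0_le_integral => //.
  - by move=> x _; rewrite lee_fin bump_ge0.
  - by apply/measurable_EFinP; exact: mpsi.
  - by apply/measurable_EFinP; exact: measurable_indic.
  - by move=> x _; rewrite lee_fin.
have lim_psi x : limn (fun k => (psi k b x)%:E) = (\1_(J b) x)%:E.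
  apply/cvg_lim => //; apply: cvg_EFin; first exact: nearW.
  rewrite indicE; have [xJ|xJ] := boolP (x \in J b).
    have /andP[lx xr] : cl + bl * b < x < cr + br * b.
      by move: xJ; rewrite inE /J /= in_itv.
    rewrite -[X in _ --> X]mulr1; apply: cvgM; apply: flat_exp0_cvg; lra.
  apply: cvg_near_cst; apply: nearW => k.
  apply/eqP; apply: contraNT xJ => /(bump_neq0 (ltr0Sn R k)) h.
  by rewrite inE /J /= in_itv.
have := @cvg_monotone_convergence _ _ _ (mu b i) setT measurableT
  (fun k x => (psi k b x)%:E).
move=> /(_ _)/wrap[|mc].
  by move=> k; apply/measurable_EFinP; exact: mpsi.
move: mc => /(_ _)/wrap[|mc].
  by move=> k x _; rewrite lee_fin bump_ge0.
move: mc => /(_ _)/wrap[|mc].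
  move=> x _ k l kl; rewrite lee_fin /psi /moving_bump.
  have [h|h] := leP x (cl + bl * b).
    by rewrite !(@flat_exp_le0 _ _ (_ * (x - _))) ?mul0r// pmulr_rle0// subr_le0.
  have [h'|h'] := leP (cr + br * b) x.
    rewrite ![_ * flat_exp _ (_ * (_ - x))]mulrC.
    by rewrite !(@flat_exp_le0 _ _ (_ * (_ - x))) ?mul0r// pmulr_rle0// subr_le0.
  by rewrite ler_pM ?flat_exp_ge0// flat_exp0_le// ler_wpM2r ?subr_ge0 ?(ltW h) ?(ltW h')// ler_nat.
have <- : (\int[mu b i]_x limn (fun k => (psi k b x)%:E) = mu b i (J b))%E.
  by under eq_integral do rewrite lim_psi; rewrite integral_indic// setIT.
rewrite -(cvg_lim _ mc)//.
by apply: lime_le; [apply/cvg_ex; eexists; exact: mc|apply: nearW => k; exact: upper].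
Qed.

End IntervalTransport.

(** * A bound on the velocity at the origin *)

Section VelocityBound.
Context {R : realType} {n : nat}.
Variables (m p : 'I_n -> R) (E : R) (W : R -> 'M[R]_n).
Variables (mu : R -> 'I_n -> borel_measure R) (i : 'I_n).
Hypothesis m_gt0 : forall j, 0 < m j.
Hypothesis p_gt0 : forall j, 0 < p j.
Hypothesis mu_AC : AC2_loc (in_P m p E) (dist_P m) mu.
Hypothesis W'_lipschitz : forall j, lipschitz (derive1 (fun z => W z i j)).

Notation v := (velocity m W mu i).

(** By the modulus for error 1, [v t 0] changes by at most 1 over a time step [d / 2], and finitely
    many steps cover [[0, T]]. The Lipschitz bound in space then controls linear growth away from
    0. *)
Lemma velocity_bounded (T : R) : 0 < T ->
  exists2 V, 0 <= V & forall t, 0 <= t <= T -> `|v t 0| <= V.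
Proof.
move=> T0.
have [d d0 dP] := velocity_modulus m_gt0 p_gt0 mu_AC W'_lipschitz T0 ltr01.
have step k t : 0 <= t <= T -> t <= k%:R * (d / 2) -> `|v t 0| <= `|v 0 0| + k%:R.
  elim: k t => [|k ih] t /andP[t0 tT] tk.
    have -> : t = 0 by apply/eqP; rewrite eq_le t0 andbT; move: tk; rewrite mul0r.
    by rewrite addr0.
  pose s := Num.max 0 (t - d / 2).
  have d2 : 0 < d / 2 by rewrite divr_gt0.
  have st : s <= t by rewrite ge_max t0 gerBl ltW.
  have s0 : 0 <= s by rewrite le_max lexx.
  have sT : 0 <= s <= T by rewrite s0 (le_trans st).
  have sk : s <= k%:R * (d / 2).
    rewrite ge_max mulr_ge0 ?(ltW d2)//= lerBlDr.
    by apply: le_trans tk _; rewrite -[k.+1]addn1 natrD mulrDl mul1r.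
  have tT' : 0 <= t <= T by rewrite t0.
  have ts : `|t - s| < d.
    rewrite ger0_norm ?subr_ge0// ltrBlDl.
    have : t - d / 2 <= s by rewrite le_max lexx orbT.
    lra.
  have h1 := dP t s 0 tT' sT ts; have h2 := ih s sT sk.
  have -> : v t 0 = v s 0 + (v t 0 - v s 0) by ring.
  apply: le_trans (ler_normD _ _) _.
  by rewrite -[k.+1]addn1 natrD addrA; exact: lerD.
pose k := (Num.truncn (T / (d / 2))).+1.
exists (`|v 0 0| + k%:R); first by rewrite addr_ge0.
move=> t /[dup] tT /andP[_ ht]; apply: step => //; apply: le_trans ht _.
rewrite -ler_pdivrMr ?divr_gt0//; apply/ltW; exact: truncnS_gt.
Qed.

End VelocityBound.

(** * Euler polygons followed backwards in time *)

Section EulerChain.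
Context {R : realType}.
Variables (nu : R -> borel_measure R) (v : R -> R -> R) (L : R).
Hypothesis L0 : 0 <= L.
Hypothesis v_lipschitz :
  forall t x y, 0 <= t -> `|v t x - v t y| <= L * `|x - y|.
Hypothesis nu_transport : forall a b cl bl cr br : R, 0 <= a -> a < b ->
  (forall t, a < t < b ->
    forall x, cl + bl * t < x < cr + br * t -> br <= v t x <= bl) ->
  (nu b `](cl + bl * b)%R, (cr + br * b)%R[%classic <=
   nu a `](cl + bl * a)%R, (cr + br * a)%R[%classic)%E.

(* The interval ]c - rho, c + rho[ is moved backwards with the constant velocity
   of its centre while its radius grows at rate (L + 1) rho: the surplus rho over
   the Lipschitz bound L rho absorbs the errors made by freezing the velocity. *)
Lemma euler_step (V B r a b c rho : R) : 0 < r -> r <= rho ->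
  0 <= a -> a < b -> `|v b 0| <= V -> `|c| + V <= B ->
  (forall t, a < t < b -> `|v t c - v b c| <= r / 4) ->
  L * (L + 1) * (b - a) * B <= r / 4 -> L * (L + 1) * (b - a) <= 1 / 4 ->
  exists c' : R,
    `|c'| + V <= (`|c| + V) * (1 + (L + 1) * (b - a)) /\
    (nu b `](c - rho)%R, (c + rho)%R[%classic <=
     nu a `](c' - rho * (1 + (L + 1) * (b - a)))%R,
              (c' + rho * (1 + (L + 1) * (b - a)))%R[%classic)%E.
Proof.
move=> r0 rrho a0 ab vb0 cB vmod hB hL.
have b0 : 0 <= b by rewrite (le_trans a0)// ltW.
pose w := v b c.
have h0 : 0 < b - a by rewrite subr_gt0.
have rho0 : 0 < rho by exact: lt_le_trans rrho.
have V0 : 0 <= V by exact: le_trans vb0.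
have wV : `|w| <= (L + 1) * (`|c| + V).
  have := @v_lipschitz b c 0 b0; rewrite subr0 => h1.
  rewrite /w (_ : v b c = v b 0 + (v b c - v b 0)); last by ring.
  apply: le_trans (ler_normD _ _) _.
  have := normr_ge0 c; have : 0 <= L * V by exact: mulr_ge0.
  rewrite mulrDl mulrDr mul1r => *; lra.
(* By [wV], the quantity [|c| + V] grows at most by the factor that multiplies the radius, so one
   estimate confines all the centres of a chain. *)
exists (c - w * (b - a)); split.
  rewrite (_ : (_ + V) * _ = `|c| + V + (L + 1) * (`|c| + V) * (b - a)); last by ring.
  have : `|c - w * (b - a)| <= `|c| + `|w| * (b - a).
    by apply: le_trans (ler_normB _ _) _; rewrite normrM (gtr0_norm h0).
  have : `|w| * (b - a) <= (L + 1) * (`|c| + V) * (b - a) by rewrite ler_wpM2r// ltW.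
  lra.
(* Forward in time the left endpoint is the faster one and the interval shrinks, so backwards it
   widens; [cl] and [cr] are fitted to the interval at time [b]. *)
pose bl := w + (L + 1) * rho; pose br := w - (L + 1) * rho.
pose cl := c - rho - bl * b; pose cr := c + rho - br * b.
have := nu_transport (cl := cl) (bl := bl) (cr := cr) (br := br) a0 ab.
have -> : cl + bl * b = c - rho by rewrite /cl; ring.
have -> : cr + br * b = c + rho by rewrite /cr; ring.
have -> : cl + bl * a = c - w * (b - a) - rho * (1 + (L + 1) * (b - a)).
  by rewrite /cl /bl; ring.
have -> : cr + br * a = c - w * (b - a) + rho * (1 + (L + 1) * (b - a)).
  by rewrite /cr /br; ring.
apply => t tab x /andP[lx xr]; have /andP[a_t t_b] := tab.
have t0 : 0 <= t by rewrite (le_trans a0)// ltW.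
have tb0 : 0 <= b - t by rewrite subr_ge0 ltW.
have tba : b - t <= b - a by rewrite lerD2l lerN2 ltW.
have xc : `|x - c| <= `|w| * (b - a) + rho + (L + 1) * rho * (b - a).
  have h1 : `|x - (c - w * (b - t))| <= rho + (L + 1) * rho * (b - t).
    rewrite ler_norml; apply/andP; split.
      by move: lx; rewrite /cl /bl => lx; lra.
    by move: xr; rewrite /cr /br => xr; lra.
  have h2 : (L + 1) * rho * (b - t) <= (L + 1) * rho * (b - a).
    by rewrite ler_wpM2l// mulr_ge0 ?addr_ge0// ltW.
  have h3 : `|w * (b - t)| <= `|w| * (b - a) by rewrite normrM ler_wpM2l// ger0_norm.
  rewrite (_ : x - c = x - (c - w * (b - t)) - w * (b - t)); last by ring.
  apply: le_trans (ler_normB _ _) _; lra.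
(* Error budget: [L * rho] from the radius, and at most [rho / 4] each from the motion of the
   centre, the widening and the change of [v] in time. The sum stays below [(L + 1) * rho]. *)
have main : `|v t x - w| <= (L + 1) * rho.
  rewrite (_ : v t x - w = (v t x - v t c) + (v t c - v b c)); last by rewrite /w; ring.
  apply: le_trans (ler_normD _ _) _.
  have h1 : L * `|x - c| <= L * (`|w| * (b - a) + rho + (L + 1) * rho * (b - a)).
    exact: ler_wpM2l.
  have h2 := @v_lipschitz t x c t0; have h3 := vmod t tab.
  have h4 : L * (`|w| * (b - a)) <= r / 4.
    apply: le_trans hB; rewrite -!mulrA ler_wpM2l//.
    rewrite [leRHS](_ : _ = (L + 1) * B * (b - a)); last by ring.
    rewrite ler_wpM2r ?(ltW h0)//; apply: le_trans wV _.
    by rewrite ler_wpM2l// addr_ge0.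
  have h5 : L * ((L + 1) * rho * (b - a)) <= rho / 4.
    have -> : L * ((L + 1) * rho * (b - a)) = L * (L + 1) * (b - a) * rho by ring.
    apply: le_trans (ler_wpM2r (ltW rho0) hL) _; lra.
  rewrite mulrDl mul1r.
  rewrite !mulrDr in h1; lra.
move: main; rewrite ler_norml /br /bl => /andP[]; rewrite lerBrDl lerBlDl => h1 h2.
by apply/andP; split; lra.
Qed.

(** The number of steps [N] depends on [c] and [r], but [(1 + lam * h) ^+ N <= expR (lam * T)]
    because [N * h = T]; hence [C] can be chosen before them. *)
Lemma open_interval_backward (T V : R) : 0 < T -> 0 <= V ->
  (forall t, 0 <= t <= T -> `|v t 0| <= V) ->
  (forall e, 0 < e -> exists2 d, 0 < d & forall s t x, 0 <= s <= T ->
    0 <= t <= T -> `|s - t| < d -> `|v s x - v t x| <= e) ->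
  exists2 C, 0 <= C & forall c r : R, 0 < r -> exists c' : R, exists2 r' : R,
    r <= r' <= C * r &
    (nu T `](c - r)%R, (c + r)%R[%classic <=
     nu 0 `](c' - r')%R, (c' + r')%R[%classic)%E.
Proof.
move=> T0 V0 VP v_modulus.
pose lam := L + 1; have lam0 : 0 < lam by rewrite ltr_wpDl.
pose C := expR (lam * T).
exists C; first exact: expR_ge0.
move=> c r r0.
have [d d0 dP] := v_modulus _ (divr_gt0 r0 (ltr0n R 4)).
(* An a priori bound for [|c'| + V] at every centre [c'] of the chain, needed before the step length
   can be chosen. *)
pose B := (`|c| + V) * C.
have B0 : 0 <= B by rewrite mulr_ge0 ?expR_ge0// addr_ge0.
have K0 : 0 < 4 * (L * lam * (B / r + 1)) + 1.
  by rewrite ltr_wpDl// !mulr_ge0 ?(ltW lam0)// addr_ge0// divr_ge0// ltW.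
(* The second entry gives [L * lam * h * (B / r + 1) <= 1 / 4], which contains both smallness
   conditions of [euler_step]; the added 1 makes it invertible when [L = 0]. *)
pose del := Num.min d (4 * (L * lam * (B / r + 1)) + 1)^-1.
have del0 : 0 < del by rewrite lt_min d0 invr_gt0.
pose N := (Num.truncn (T / del)).+1.
pose h := T / N%:R.
have N0 : 0 < N%:R :> R by rewrite ltr0n.
have h0 : 0 < h by rewrite divr_gt0.
have hdel : h < del.
  by rewrite /h ltr_pdivrMr// mulrC -ltr_pdivrMr// truncnS_gt.
have hd : h < d by rewrite (lt_le_trans hdel)// ge_min lexx.
have hK : h * (4 * (L * lam * (B / r + 1)) + 1) <= 1.
  by rewrite -ler_pdivlMr// div1r ltW// (lt_le_trans hdel)// ge_min lexx orbT.
have Lh0 : 0 <= L * lam * h by rewrite !mulr_ge0// ltW.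
have hL : L * lam * h <= 1 / 4.
  have : 0 <= L * lam * h * (B / r) by rewrite mulr_ge0// divr_ge0// ltW.
  have -> : L * lam * h * (B / r) = h * (L * lam * (B / r + 1)) - L * lam * h by ring.
  lra.
have hB : L * lam * h * B <= r / 4.
  have hBr : L * lam * h * (B / r) <= 1 / 4.
    have -> : L * lam * h * (B / r) = h * (L * lam * (B / r + 1)) - L * lam * h by ring.
    lra.
  have -> : L * lam * h * B = L * lam * h * (B / r) * r by field; rewrite gt_eqF.
  have := ler_wpM2r (ltW r0) hBr; lra.
have growth k : (k <= N)%N -> (1 + lam * h) ^+ k <= C.
  move=> kN; apply: (@le_trans _ _ (expR (lam * h) ^+ k)).
    by apply: lerXn2r; rewrite ?nnegrE ?expR_ge0 ?expR_ge1Dx// addr_ge0// mulr_ge0// ltW.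
  rewrite -expRM_natl /C ler_expR mulrCA ler_wpM2l ?(ltW lam0)//.
  by rewrite /h mulrCA ger_pMr// ler_pdivrMr// mul1r ler_nat.
have one_h : 1 <= 1 + lam * h by rewrite lerDl mulr_ge0// ltW.
have chain k : (k <= N)%N -> exists c', exists2 rho,
    rho = r * (1 + lam * h) ^+ k & `|c'| + V <= (`|c| + V) * (1 + lam * h) ^+ k /\
    (nu T `](c - r)%R, (c + r)%R[%classic <=
     nu (T - k%:R * h)%R `](c' - rho)%R, (c' + rho)%R[%classic)%E.
  elim: k => [|k ih] kN.
    by exists c, r; rewrite ?expr0 ?mulr1// mul0r subr0.
  have [c1 [rho rhoE [c1V le1]]] := ih (ltnW kN).
  have kh : k.+1%:R * h <= T.
    by rewrite /h mulrCA ger_pMr// ler_pdivrMr// mul1r ler_nat.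
  have kS : k.+1%:R * h = k%:R * h + h by rewrite -[k.+1]addn1 natrD mulrDl mul1r.
  pose b := T - k%:R * h; pose a := T - k.+1%:R * h.
  have bah : b - a = h by rewrite /a /b kS; ring.
  have a0 : 0 <= a by rewrite subr_ge0.
  have ab : a < b by rewrite -subr_gt0 bah.
  have bT : 0 <= b <= T.
    by rewrite (le_trans a0 (ltW ab))/= gerBl mulr_ge0// ltW.
  have pow1 : 1 <= (1 + lam * h) ^+ k by rewrite exprn_ege1.
  have rrho : r <= rho by rewrite rhoE ler_peMr// ltW.
  have c1B : `|c1| + V <= B.
    by apply: le_trans c1V _; rewrite ler_wpM2l ?growth ?(ltnW kN)// addr_ge0.
  have [] := @euler_step V B r a b c1 rho r0 rrho a0 ab (VP _ bT) c1B.
  - move=> t /andP[a_t t_b]; apply: dP => //.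
      have /andP[_ bT'] := bT.
      by rewrite (le_trans a0 (ltW a_t)) (le_trans (ltW t_b)).
    rewrite distrC gtr0_norm ?subr_gt0//; apply: le_lt_trans hd.
    by rewrite -bah lerD2l lerN2 ltW.
  - by rewrite bah.
  - by rewrite bah.
  move=> c2 [c2V le2]; exists c2, (rho * (1 + lam * h)).
    by rewrite rhoE exprSr mulrA.
  split; last by move: le2; rewrite bah; exact: le_trans.
  apply: (le_trans c2V); rewrite bah -/lam exprSr [leRHS]mulrA ler_wpM2r//.
  by rewrite (le_trans ler01).
have [c' [rho rhoE [_ le]]] := chain N (leqnn N).
exists c', rho.
  rewrite rhoE ler_peMr ?(ltW r0) ?exprn_ege1//=.
  by rewrite [leRHS]mulrC ler_wpM2l ?(ltW r0) ?growth.
have TN : T - N%:R * h = 0 by rewrite /h mulrCA divff ?gt_eqF// mulr1 subrr.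
by move: le; rewrite TN.
Qed.

End EulerChain.

(** * Absolute continuity at every time *)

Lemma density_open_itv (R : realType) (mu : borel_measure R)
    (f : measurableTypeR R -> R) (M a b : R) :
  is_density mu f -> (forall x, f x <= M) -> a <= b ->
  (mu `]a, b[%classic <= (M * (b - a))%:E)%E.
Proof.
move=> [mf f0 muE] fM ab; rewrite muE; last exact: measurable_itv.
apply: (@le_trans _ _ (\int[lebesgue_measure]_(x in `]a, b[) (cst M%:E x))%E).
  apply: ge0_le_integral => //=.
  - by move=> x _; rewrite lee_fin.
  - by apply/measurable_EFinP; apply: measurable_funTS.
  - by move=> x _; rewrite lee_fin.
have lenE : lebesgue_measure `]a, b[%classic = (b - a)%:E.
  rewrite lebesgue_measure_itv/= lte_fin.
  by move: ab; rewrite le_eqVlt => /predU1P[->|->//]; rewrite ltxx subrr.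
rewrite (integral_cst lebesgue_measure (measurable_itv _) M%:E) EFinM.
by apply: lee_wpmul2l; [rewrite lee_fin (le_trans (f0 0))|rewrite -lenE].
Qed.

Theorem proposition3p5 (R : realType) (n : nat) (m p : 'I_n -> R) (E : R)
    (W : R -> 'M[R]_n) (mu0 : 'I_n -> borel_measure R)
    (mu : R -> 'I_n -> borel_measure R) (i : 'I_n)
    (f : measurableTypeR R -> R)
    (m_gt0 : forall j, 0 < m j) (p_gt0 : forall j, 0 < p j)
    (W_admissible : admissible W)
    (mu0_P : in_P m p E mu0)
    (mu_sol : gradient_flow_solution m p E W mu0 mu)
    (W'_lipschitz : forall j, lipschitz (derive1 (fun z => W z i j)))
    (supp_interval : is_interval (supp (mu0 i)))
    (mu0_ac : mu0 i `<< lebesgue_measure)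
    (mu0_density : is_density (mu0 i) f)
    (f_continuous : forall x : R, (supp (mu0 i))° x ->
       {for x, continuous (f : R -> R)})
    (f_bounded : bounded_fun (f : R -> R)) :
  forall t : R, 0 <= t -> mu t i `<< lebesgue_measure.
Proof.
have [mu_AC mu_init mu_dist] := mu_sol.
have [M fM] : exists M, forall x, f x <= M.
  have [B [_ BP]] := f_bounded; exists (`|B| + 1) => x.
  apply: le_trans (ler_norm _) _; apply: (BP (`|B| + 1)) => //.
  by rewrite (le_lt_trans (ler_norm _))// ltrDl.
(* Time 0 is settled by the hypothesis on [mu0 i], since the backward estimate is stated for
   [0 < T]. *)
move=> t; rewrite le_eqVlt => /predU1P[<-|t0].
  by move=> N nullN A mA AN; rewrite mu_init//; exact: mu0_ac nullN A mA AN.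
have [L L0 LP] := velocity_lipschitz m_gt0 p_gt0 mu_AC W'_lipschitz.
have [V V0 VP] := velocity_bounded m_gt0 p_gt0 mu_AC W'_lipschitz t0.
have [C C0 CP] := @open_interval_backward R (fun t => mu t i) (velocity m W mu i) L
  L0 LP (fun a b cl bl cr br a0 ab hv =>
    interval_transport m_gt0 p_gt0 mu_AC W'_lipschitz mu_dist a0 ab hv)
  t V t0 V0 VP (fun e e0 => velocity_modulus m_gt0 p_gt0 mu_AC W'_lipschitz t0 e0).
have M0 : 0 <= M by case: mu0_density => _ /(_ 0) f0 _; exact: le_trans (fM 0).
(* [M] bounds the initial density and [C] the dilation of lengths: with centre [c] and radius [r],
   the interval at time 0 has length [2 * r' <= C * (y - x)]. *)
apply: (@null_dominates_open_itv _ _ (M * C)); first exact: mulr_ge0.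
move=> x y xy; pose c := (x + y) / 2; pose r := (y - x) / 2.
have r0 : 0 < r by rewrite divr_gt0// subr_gt0.
have [c' [r' /andP[rr' r'C]]] := CP c r r0.
have -> : c - r = x by rewrite /c /r; field.
have -> : c + r = y by rewrite /c /r; field.
move=> /le_trans; apply; rewrite mu_init; last exact: measurable_itv.
apply: (le_trans (density_open_itv mu0_density fM _)).
  by have := ltW (lt_le_trans r0 rr'); lra.
rewrite lee_fin -mulrA ler_wpM2l//.
have -> : c' + r' - (c' - r') = 2 * r' by ring.
have -> : y - x = 2 * r by rewrite /r; field.
by rewrite mulrCA ler_wpM2l.
Qed.
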